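(* Let $\Lambda$ be a filtered ring whose associated graded ring $\mathrm{gr}\Lambda$ is a commutative Noetherian ring. Let $M$ be a filtered (left) $\Lambda$-module with a good filtration such that the $\mathrm{gr}\Lambda$-module $\mathrm{gr}M$ has finite Gorenstein dimension. Then $$\text{G-dim}_{\Lambda} M\leq \text{G-dim}_{\mathrm{gr}\Lambda}\,\mathrm{gr}M .$$
   Context: A filtered ring is a ring $\Lambda$ with additive subgroups $\mathcal F_p\Lambda$ ($p\in\mathbb N=\{0,1,2,\dots\}$) such that $1\in\mathcal F_0\Lambda$, $\mathcal F_p\Lambda\subset\mathcal F_{p+1}\Lambda$, $(\mathcal F_p\Lambda)(\mathcal F_q\Lambda)\subset\mathcal F_{p+q}\Lambda$, $\Lambda=\bigcup_p\mathcal F_p\Lambda$; put $\mathcal F_p\Lambda=0$ for $p<0$ and $\mathrm{gr}\Lambda=\bigoplus_{p\ge 0}\mathcal F_p\Lambda/\mathcal F_{p-1}\Lambda$, a graded ring. When $\mathrm{gr}\Lambda$ is commutative Noetherian, $\Lambda$ is left and right Noetherian. A filtration of a $\Lambda$-module $M$ is a family of additive subgroups $\mathcal F_pM$ ($p\in\mathbb Z$) with $\mathcal F_pM\subset\mathcal F_{p+1}M$, $\mathcal F_{-p}M=0$ for $p\gg0$, $(\mathcal F_p\Lambda)(\mathcal F_qM)\subset\mathcal F_{p+q}M$, $M=\bigcup_p\mathcal F_pM$; put $\mathrm{gr}M=\bigoplus_{p\in\mathbb Z}\mathcal F_pM/\mathcal F_{p-1}M$, a graded $\mathrm{gr}\Lambda$-module.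 The filtration is good if there are $p_1,\dots,p_r\in\mathbb Z$ and $m_1,\dots,m_r\in M$ with $\mathcal F_pM=\sum_{k=1}^r(\mathcal F_{p-p_k}\Lambda)m_k$ for all $p\in\mathbb Z$ (then $M$ is finitely generated over $\Lambda$ and $\mathrm{gr}M$ is finitely generated over $\mathrm{gr}\Lambda$). Gorenstein dimension: for a left and right Noetherian ring $\Gamma$ and a finitely generated $\Gamma$-module $X$, put $X^*=\mathrm{Hom}_\Gamma(X,\Gamma)$. One says $\text{G-dim}_\Gamma X=0$ if the canonical map $X\to X^{**}$ is an isomorphism and $\mathrm{Ext}^k_\Gamma(X,\Gamma)=0=\mathrm{Ext}^k_{\Gamma^{\rm op}}(X^*,\Gamma)$ for all $k>0$. For $k>0$, $\text{G-dim}_\Gamma X\le k$ means there is an exact sequence $0\to G_k\to\cdots\to G_0\to X\to0$ of finitely generated modules with $\text{G-dim}\,G_i=0$ for all $i$; $\text{G-dim}_\Gamma X$ is the least such $k$ ($\infty$ if none exists). *)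

(* Defs.v *)
From HB Require Import structures.
From mathcomp Require Import all_boot all_order all_algebra.
From mathcomp Require Import all_classical.
From mathcomp Require Import constructive_ereal.
From mathcomp Require Import zify.

Set Implicit Arguments.
Unset Strict Implicit.
Unset Printing Implicit Defensive.

Import Order.TTheory GRing.Theory.

Local Open Scope classical_set_scope.
Local Open Scope quotient_scope.
Local Open Scope ring_scope.

Definition additive_subgroup (V : zmodType) (A : set V) : Prop :=
  A 0 /\ forall x y, A x -> A y -> A (x - y).

Lemma additive_subgroup0 (V : zmodType) : additive_subgroup [set (0 : V)].
Proof. by split=> // x y /= -> ->; rewrite subr0. Qed.

Section SubgroupTheory.
Variables (V : zmodType) (A : set V) (hA : additive_subgroup A).

Lemma subgroupN x : A x -> A (- x).
Proof. by move=> Ax; rewrite -sub0r; apply: hA.2 => //; exact: hA.1. Qed.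

Lemma subgroupD x y : A x -> A y -> A (x + y).
Proof. by move=> Ax Ay; rewrite -[y]opprK; apply: hA.2 => //; exact: subgroupN. Qed.

Lemma subgroup_sum (I : Type) (r : seq I) (P : pred I) (f : I -> V) :
  (forall i, P i -> A (f i)) -> A (\sum_(i <- r | P i) f i).
Proof. by move=> Af; elim/big_ind: _ => //; [exact: hA.1|exact: subgroupD]. Qed.
End SubgroupTheory.

(* [dsum D] is the direct sum over [i : I] of the quotient groups
   [num D i / den D i].  A family of cosets that are almost all zero is
   represented by a finitely supported family of elements of [num D i], and two
   such families are identified when they are congruent modulo [den D i] in
   every degree [i]. *)
Record subquot (I : Type) (V : zmodType) := Subquot {
  num : I -> set V;
  den : I -> set V;
  numP : forall i, additive_subgroup (num i);
  denP : forall i, additive_subgroup (den i);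
  den_num : forall i, den i `<=` num i }.

Section DirectSum.
Variables (I : Type) (V : zmodType) (D : subquot I V).

Definition is_family (f : I -> V) : Prop :=
  finite_set [set i | f i != 0] /\ forall i, num D i (f i).

Definition family_pred : pred (I -> V) := fun f => `[< is_family f >].

Lemma family_zmod_closed : zmod_closed family_pred.
Proof.
split=> [|f g /asboolP[ff nf] /asboolP[fg ng]]; apply/asboolP; split.
- suff -> : [set i | (0 : I -> V) i != 0] = set0 by exact: finite_set0.
  by apply/seteqP; split=> i //=; rewrite eqxx.
- by move=> i; exact: (numP D i).1.
- apply: (@sub_finite_set _ _ ([set i | f i != 0] `|` [set i | g i != 0])).
    move=> i /= h; have [fi0|] := eqVneq (f i) 0; last by left.
    right; apply: contraNN h => /eqP gi0.
    by rewrite -[(f - g) i]/(f i - g i) fi0 gi0 subrr.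
  by rewrite finite_setU.
- by move=> i; exact: (numP D i).2.
Qed.

HB.instance Definition _ :=
  GRing.isZmodClosed.Build (I -> V) family_pred family_zmod_closed.

Record family := Family { family_val :> I -> V; _ : family_pred family_val }.
HB.instance Definition _ := [isSub for family_val].
HB.instance Definition _ := [Choice of family by <:].
HB.instance Definition _ := [SubChoice_isSubZmodule of family by <:].

Definition mk_family (f : I -> V) (hf : is_family f) : family :=
  Family (asboolT hf).

Lemma familyP (f : family) : is_family f.
Proof. by case: f => f /= /asboolP. Qed.

Definition null_pred : pred family := fun f => `[< forall i, den D i (f i) >].

Lemma null_zmod_closed : zmod_closed null_pred.
Proof.
split=> [|f g /asboolP nf /asboolP ng]; apply/asboolP => i.
  exact: (denP D i).1.
exact: (denP D i).2.
Qed.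

Definition null_families : zmodClosed family :=
  HB.pack_for (zmodClosed family) null_pred
    (GRing.isZmodClosed.Build family null_pred null_zmod_closed).

Definition dsum : Type := Quotient.quot null_families.
HB.instance Definition _ := GRing.Zmodule.on dsum.

Definition cls (f : family) : dsum := \pi_(Quotient.quot null_families) f.
Definition rep (x : dsum) : family := repr (x : Quotient.quot null_families).

Lemma repK x : cls (rep x) = x.
Proof. exact: reprK. Qed.

Lemma clsE (f g : family) : (cls f = cls g) <-> (forall i, den D i (f i - g i)).
Proof.
rewrite /cls; split=> [/eqP|h]; last apply/eqP.
  by rewrite -Quotient.idealrBE => /asboolP.
by rewrite -Quotient.idealrBE; apply/asboolP.
Qed.

Lemma clsD f g : cls (f + g) = cls f + cls g.
Proof. by rewrite /cls piE. Qed.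

Lemma rep_cls f i : den D i (rep (cls f) i - f i).
Proof. by move: i; apply/clsE; rewrite repK. Qed.

End DirectSum.

Record ring_filtration (R : pzRingType) := RingFiltration {
  rfil :> nat -> set R;
  rfil_subgroup : forall p, additive_subgroup (rfil p);
  rfil1 : rfil 0%N 1;
  rfilS : forall p, rfil p `<=` rfil p.+1;
  rfilM : forall p q x y, rfil p x -> rfil q y -> rfil (p + q)%N (x * y);
  rfil_cover : forall x, exists p, rfil p x }.

(* The ring filtration extended by [0] in negative degrees. *)
Definition rfilZ (R : pzRingType) (F : ring_filtration R) (p : int) : set R :=
  match p with Posz n => F n | Negz _ => [set 0] end.

Record module_filtration (R : pzRingType) (F : ring_filtration R)
    (M : lmodType R) := ModuleFiltration {
  mfil :> int -> set M;
  mfil_subgroup : forall p, additive_subgroup (mfil p);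
  mfilS : forall p, mfil p `<=` mfil (p + 1);
  mfil_bounded : exists p0 : int, forall p, p0 <= p -> mfil (- p) = [set 0];
  mfilM : forall (p : nat) (q : int) a x,
    F p a -> mfil q x -> mfil (p%:Z + q) (a *: x);
  mfil_cover : forall x, exists p, mfil p x }.

Definition good_filtration (R : pzRingType) (F : ring_filtration R)
    (M : lmodType R) (FM : module_filtration F M) : Prop :=
  exists (r : nat) (d : 'I_r -> int) (m : 'I_r -> M), forall p : int,
    FM p = [set x | exists a : 'I_r -> R,
      (forall k, rfilZ F (p - d k) (a k)) /\ x = \sum_(k < r) a k *: m k].

Section RingFiltrationTheory.
Variables (R : pzRingType) (F : ring_filtration R).

Lemma rfilZ_subgroup p : additive_subgroup (rfilZ F p).
Proof.
by case: p => n /=; [exact: rfil_subgroup|exact: additive_subgroup0].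
Qed.

Lemma rfilZ_pred p : rfilZ F (p%:Z - 1) `<=` F p.
Proof.
case: p => [|p] x.
  by rewrite sub0r /= => ->; exact: (rfil_subgroup F 0).1.
by rewrite -[p.+1]addn1 PoszD addrK /= addn1; exact: rfilS.
Qed.

Lemma rfilZMl p q x y : rfilZ F (p%:Z - 1) x -> F q y ->
  rfilZ F ((p + q)%N%:Z - 1) (x * y).
Proof.
case: p => [|p]; first by rewrite sub0r => /= -> _; rewrite mul0r; exact: (rfilZ_subgroup _).1.
rewrite addSn -[p.+1]addn1 -[(p + q).+1]addn1 !PoszD !addrK /=.
exact: rfilM.
Qed.

Lemma rfilZMr p q x y : F p x -> rfilZ F (q%:Z - 1) y ->
  rfilZ F ((p + q)%N%:Z - 1) (x * y).
Proof.
case: q => [|q]; first by rewrite sub0r => /= _ ->; rewrite mulr0; exact: (rfilZ_subgroup _).1.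
rewrite addnS -[q.+1]addn1 -[(p + q).+1]addn1 !PoszD !addrK /=.
exact: rfilM.
Qed.
End RingFiltrationTheory.

Lemma finite_nat_bound (A : set nat) :
  finite_set A -> exists N, forall i, A i -> (i < N)%N.
Proof.
move=> /finite_seqP[s ->]; exists (\max_(i <- s) i).+1 => i /= si.
by rewrite ltnS; exact: leq_bigmax_seq.
Qed.

(* [conv] and [act] extend the products
   [F_p x F_q -> F_(p + q)] and [F_p x FM_q -> FM_(p + q)] to finitely supported
   families; [gr_mul] and [gr_scale] below are what they induce on classes, i.e.
   the bilinear extensions of [[a]_p [b]_q = [a b]_(p + q)] and
   [[a]_p [m]_q = [a m]_(p + q)]. *)
Section Convolution.
Variables (R : pzRingType) (M : lmodType R).
Implicit Types (a b c : nat -> R) (f g : int -> M).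

Definition conv a b : nat -> R := fun n => \sum_(i < n.+1) a i * b (n - i)%N.

Definition act a f : int -> M :=
  fun n => \sum_(i \in [set: nat]) a i *: f (n - i%:Z).

Definition delta1 : nat -> R := fun i => if i is 0%N then 1 else 0.

Lemma convE a b n : conv a b n = \sum_(0 <= i < n.+1) a i * b (n - i)%N.
Proof. by rewrite /conv big_mkord. Qed.

Lemma convA a b c : conv a (conv b c) = conv (conv a b) c.
Proof.
apply/funext => n; rewrite /conv.
pose coef3 i j := a i * (b (n - i - j)%N * c j).
transitivity (\sum_(i < n.+1) \sum_(j < n.+1 | (j <= n - i)%N) coef3 i j).
  apply: eq_bigr => i _; rewrite big_distrr /=.
  have -> : \sum_(j < n.+1 | (j <= n - i)%N) coef3 i j
      = \sum_(j < (n - i).+1) coef3 i j.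
    by rewrite [RHS](big_ord_widen n.+1) // ltnS leq_subr.
  rewrite (reindex_inj rev_ord_inj) /=; apply: eq_bigr => j _.
  by rewrite /coef3 subSS; congr (_ * (_ * c _)); rewrite subKn // -ltnS.
transitivity (\sum_(j < n.+1) \sum_(i < n.+1 | (i <= n - j)%N) coef3 i j).
  rewrite (exchange_big_dep predT) //=; apply: eq_bigr => j _.
  apply: eq_bigl => i.
  by rewrite !leq_subRL -1?ltnS // addnC.
rewrite (reindex_inj rev_ord_inj) /=; apply: eq_bigr => j _.
rewrite subSS big_distrl /= subKn -1?ltnS //.
rewrite (big_ord_widen n.+1 (fun i => a i * b (j - i)%N * c (n - j)%N)) //.
by apply: eq_big => i; rewrite ?ltnS // => ij; rewrite /coef3 -subnAC subKn -1?ltnS // mulrA.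
Qed.

Lemma conv1l a : conv delta1 a = a.
Proof.
apply/funext => n; rewrite /conv big_ord_recl big1 /= ?subn0 ?mul1r ?addr0 //.
by move=> i _; rewrite mul0r.
Qed.

Lemma conv1r a : conv a delta1 = a.
Proof.
apply/funext => n; rewrite /conv big_ord_recr big1 /= ?subnn ?mulr1 ?add0r //.
move=> i _; rewrite /delta1; case E: (n - i)%N => [|k]; last by rewrite mulr0.
by move/eqP: E; rewrite subn_eq0 leqNgt ltn_ord.
Qed.

Lemma convDl a b c : conv (a + b) c = conv a c + conv b c.
Proof.
apply/funext => n; rewrite -[RHS]/(conv a c n + conv b c n) /conv -big_split /=.
by apply: eq_bigr => i _; rewrite -mulrDl.
Qed.

Lemma convDr a b c : conv a (b + c) = conv a b + conv a c.
Proof.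
apply/funext => n; rewrite -[RHS]/(conv a b n + conv a c n) /conv -big_split /=.
by apply: eq_bigr => i _; rewrite -mulrDr.
Qed.

Lemma actE N a f n : (forall i, (N <= i)%N -> a i = 0) ->
  act a f n = \sum_(i < N) a i *: f (n - i%:Z).
Proof.
move=> aN; rewrite /act (fsbig_ord _ N (fun i => a i *: f (n - i%:Z))).
apply/esym/fsbig_widen => // i [_ /= /negP]; rewrite -leqNgt => Ni.
by rewrite aN // scale0r.
Qed.

Lemma act_conv N1 N2 a b f :
    (forall i, (N1 <= i)%N -> a i = 0) -> (forall i, (N2 <= i)%N -> b i = 0) ->
  act (conv a b) f = act a (act b f).
Proof.
move=> aN bN; apply/funext => n.
rewrite (actE (N := N1) _ _ aN) (@actE (N1 + N2)%N); last first.
  move=> k Nk; rewrite /conv big1 // => i _.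
  have [N1i|iN1] := leqP N1 i; first by rewrite aN // mul0r.
  by rewrite (bN (k - i)%N) ?mulr0 //; lia.
pose t i k := (a i * b (k - i)%N) *: f (n - k%:Z).
transitivity (\sum_(k < N1 + N2) \sum_(i < N1 + N2 | (i <= k)%N) t i k).
  apply: eq_bigr => k _; rewrite /conv scaler_suml.
  by rewrite (big_ord_widen (N1 + N2) (fun i => t i k)) //; apply: eq_bigl => i; rewrite ltnS.
rewrite (exchange_big_dep predT) //=.
transitivity (\sum_(i < N1) \sum_(k < N1 + N2 | (i <= k)%N) t i k).
  rewrite [RHS](big_ord_widen (N1 + N2) (fun i => \sum_(k < N1 + N2 | (i <= k)%N) t i k)) ?leq_addr //.
  rewrite (bigID (fun i : 'I__ => (i < N1)%N)) /= [X in _ + X]big1 ?addr0 //.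
  move=> i; rewrite -leqNgt => N1i; apply: big1 => k _.
  by rewrite /t aN // mul0r scale0r.
apply: eq_bigr => i _.
rewrite (actE (N := (N1 + N2 - i)%N)); last first.
  by move=> j h; apply: bN; have := ltn_ord i; lia.
rewrite scaler_sumr -(big_mkord xpredT (fun j => a i *: (b j *: f (n - i%:Z - j%:Z)))).
rewrite -(big_mkord (fun k => (i <= k)%N) (t i)).
rewrite (@big_cat_nat _ _ _ i) //=; last by rewrite ltnW // (leq_trans (ltn_ord i)) // leq_addr.
rewrite big_nat_cond big1 ?add0r; last first.
  by move=> k /andP[/andP[_ ki] ik]; move: ki; rewrite ltnNge ik.
rewrite -{1}[val i]add0n big_addn big_mkcond /=.
apply: eq_bigr => j _.
by rewrite leq_addl /t addnK scalerA PoszD opprD addrA addrAC.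
Qed.

Lemma act1 f : act delta1 f = f.
Proof.
apply/funext => n; rewrite (@actE 1%N) ?big_ord1 ?subr0 ?scale1r //.
by case.
Qed.

Lemma actDr N a f g : (forall i, (N <= i)%N -> a i = 0) ->
  act a (f + g) = act a f + act a g.
Proof.
move=> aN; apply/funext => n; rewrite -[RHS]/(act a f n + act a g n).
rewrite !(actE _ _ aN) -big_split; apply: eq_bigr => i _.
by rewrite /= -scalerDr.
Qed.

Lemma actDl N a b f :
    (forall i, (N <= i)%N -> a i = 0) -> (forall i, (N <= i)%N -> b i = 0) ->
  act (a + b) f = act a f + act b f.
Proof.
move=> aN bN; apply/funext => n; rewrite -[RHS]/(act a f n + act b f n).
rewrite (actE _ _ aN) (actE _ _ bN) (@actE N) -?big_split.
  by apply: eq_bigr => i _; rewrite /= -scalerDl.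
by move=> i Ni; rewrite -[(a + b) i]/(a i + b i) aN // bN // addr0.
Qed.
End Convolution.

Section GradedRing.
Variables (R : pzRingType) (F : ring_filtration R).

Definition ring_subquot : subquot nat R :=
  Subquot (rfil_subgroup F) (fun p : nat => rfilZ_subgroup F (p%:Z - 1))
    (@rfilZ_pred R F).

Definition gr_ring : Type := dsum ring_subquot.
HB.instance Definition _ := GRing.Zmodule.on gr_ring.

Local Notation fam := (family ring_subquot).
Implicit Types a b c : fam.

Lemma fam_bound a : exists N, forall i, (N <= i)%N -> a i = 0.
Proof.
have [/finite_nat_bound[N hN] _] := familyP a; exists N => i Ni.
by apply/eqP; apply: contraLR Ni => /hN; rewrite -ltnNge.
Qed.

Lemma fam_rfil a i : F i (a i).
Proof. exact: (familyP a).2. Qed.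

Lemma conv_is_family a b : is_family ring_subquot (conv a b).
Proof.
have [N1 h1] := fam_bound a; have [N2 h2] := fam_bound b; split.
  apply: (@sub_finite_set _ _ `I_(N1 + N2)%N); last exact: finite_II.
  move=> k /= abk; rewrite ltnNge; apply: contraNN abk => Nk.
  apply/eqP/big1 => i _; have [N1i|iN1] := leqP N1 i.
    by rewrite h1 // mul0r.
  by rewrite (h2 (k - i)%N) ?mulr0 //; lia.
move=> n; apply: subgroup_sum; first exact: rfil_subgroup.
move=> i _; have ein : (i + (n - i))%N = n by have := ltn_ord i; lia.
by have := rfilM (fam_rfil a i) (fam_rfil b (n - i)%N); rewrite ein.
Qed.

Lemma delta1_is_family : is_family ring_subquot (delta1 R).
Proof.
split; last by case=> [|p]; [exact: rfil1|exact: (rfil_subgroup F p.+1).1].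
apply: (@sub_finite_set _ _ `I_1); last exact: finite_II.
by case=> //= n; rewrite eqxx.
Qed.

Definition fam_mul a b : fam := mk_family (conv_is_family a b).
Definition fam_one : fam := mk_family delta1_is_family.

Definition gr_one : gr_ring := cls fam_one.
Definition gr_mul (x y : gr_ring) : gr_ring := cls (fam_mul (rep x) (rep y)).

Lemma convBB (a a' b b' : nat -> R) n :
  conv a b n - conv a' b' n =
  \sum_(i < n.+1) ((a i - a' i) * b (n - i)%N + a' i * (b (n - i)%N - b' (n - i)%N)).
Proof.
rewrite /conv -sumrB; apply: eq_bigr => i _.
by rewrite mulrBl mulrBr addrA subrK.
Qed.

Lemma gr_mulE a b : gr_mul (cls a) (cls b) = cls (fam_mul a b).
Proof.
apply/clsE => n; rewrite /= convBB.
apply: subgroup_sum; first exact: rfilZ_subgroup.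
move=> i _; have ein : (i + (n - i))%N = n by have := ltn_ord i; lia.
apply: subgroupD; first exact: rfilZ_subgroup.
  by have := rfilZMl (rep_cls a i) (fam_rfil (rep (cls b)) (n - i)%N); rewrite ein.
by have := rfilZMr (fam_rfil a i) (rep_cls b (n - i)%N); rewrite ein.
Qed.

Lemma gr_mulA : associative gr_mul.
Proof.
move=> x y z; rewrite -[x]repK -[y]repK -[z]repK !gr_mulE.
by congr cls; apply/val_inj; rewrite /= convA.
Qed.

Lemma gr_mul1r : left_id gr_one gr_mul.
Proof.
move=> x; rewrite -[x]repK /gr_one gr_mulE.
by congr cls; apply/val_inj; rewrite /= conv1l.
Qed.

Lemma gr_mulr1 : right_id gr_one gr_mul.
Proof.
move=> x; rewrite -[x]repK /gr_one gr_mulE.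
by congr cls; apply/val_inj; rewrite /= conv1r.
Qed.

Lemma gr_mulDl : left_distributive gr_mul +%R.
Proof.
move=> x y z; rewrite -[x]repK -[y]repK -[z]repK -clsD !gr_mulE -clsD.
by congr cls; apply/val_inj; rewrite /= convDl.
Qed.

Lemma gr_mulDr : right_distributive gr_mul +%R.
Proof.
move=> x y z; rewrite -[x]repK -[y]repK -[z]repK -clsD !gr_mulE -clsD.
by congr cls; apply/val_inj; rewrite /= convDr.
Qed.

HB.instance Definition _ := GRing.Zmodule_isPzRing.Build gr_ring
  gr_mulA gr_mul1r gr_mulr1 gr_mulDl gr_mulDr.
End GradedRing.

Section GradedModule.
Variables (R : pzRingType) (F : ring_filtration R) (M : lmodType R).
Variable FM : module_filtration F M.

Lemma mfil_pred p : FM (p - 1) `<=` FM p.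
Proof. by move=> x /(mfilS (m := FM)); rewrite subrK. Qed.

Definition module_subquot : subquot int M :=
  Subquot (mfil_subgroup FM) (fun p : int => mfil_subgroup FM (p - 1)) mfil_pred.

Definition gr_mod : Type := dsum module_subquot.
HB.instance Definition _ := GRing.Zmodule.on gr_mod.

Local Notation fam := (family (ring_subquot F)).
Local Notation mfam := (family module_subquot).

Lemma mfam_mfil (f : mfam) i : FM i (f i).
Proof. exact: (familyP f).2. Qed.

Lemma act_is_family (a : fam) (f : mfam) : is_family module_subquot (act a f).
Proof.
have [N aN] := fam_bound a; split.
  pose S := [set i | f i != 0].
  apply: (@sub_finite_set _ _ ((fun ij : nat * int => ij.1%:Z + ij.2) @` (`I_N `*` S))).
    move=> n /= afn; apply: contrapT => h; move/eqP: afn; apply.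
    rewrite (actE _ _ aN) big1 // => i _.
    have [->|fi] := eqVneq (f (n - i%:Z)) 0; first by rewrite scaler0.
    by case: h; exists (val i, n - i%:Z) => //=; rewrite addrC subrK.
  apply: finite_image; apply: finite_setX; first exact: finite_II.
  exact: (familyP f).1.
move=> n; rewrite (actE _ _ aN); apply: subgroup_sum; first exact: mfil_subgroup.
move=> i _; have ein : i%:Z + (n - i%:Z) = n by rewrite addrC subrK.
by have := mfilM (fam_rfil a i) (mfam_mfil f (n - i%:Z)); rewrite ein.
Qed.

Definition fam_scale (a : fam) (f : mfam) : mfam := mk_family (act_is_family a f).

Definition gr_scale (x : gr_ring F) (u : gr_mod) : gr_mod :=
  cls (fam_scale (rep x) (rep u)).

Lemma mfilZ p q a u : rfilZ F (p%:Z - 1) a -> FM q u -> FM (p%:Z + q - 1) (a *: u).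
Proof.
case: p => [|p]; first by rewrite sub0r => /= -> _; rewrite scale0r; exact: (mfil_subgroup _ _).1.
rewrite addrAC -[p.+1]addn1 !PoszD !addrK /=.
exact: mfilM.
Qed.

Lemma gr_scaleE (a : fam) (f : mfam) : gr_scale (cls a) (cls f) = cls (fam_scale a f).
Proof.
apply/clsE => n /=.
have [N1 h1] := fam_bound a; have [N2 h2] := fam_bound (rep (cls a)).
pose N := maxn N1 N2.
rewrite (@actE _ _ N (rep _)); last by move=> i Ni; apply: h2; lia.
rewrite (@actE _ _ N a); last by move=> i Ni; apply: h1; lia.
rewrite -sumrB; apply: subgroup_sum; first exact: mfil_subgroup.
move=> i _; set a' := rep (cls a); set f' := rep (cls f); set j := n - i%:Z.
have -> : a' i *: f' j - a i *: f j = (a' i - a i) *: f' j + a i *: (f' j - f j).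
  by rewrite scalerBl scalerBr addrA subrK.
have -> : n = i%:Z + j by rewrite addrC subrK.
apply: subgroupD; first exact: mfil_subgroup.
  by apply: mfilZ; [exact: (rep_cls a i)|exact: mfam_mfil].
rewrite -addrA; apply: mfilM; first exact: fam_rfil.
exact: (rep_cls f j).
Qed.

Lemma gr_scaleA x y u : gr_scale x (gr_scale y u) = gr_scale (x * y) u.
Proof.
rewrite -[x]repK -[y]repK -[u]repK -[_ * _]/(gr_mul _ _) gr_mulE !gr_scaleE.
congr cls; apply/val_inj => /=.
have [N1 h1] := fam_bound (rep x); have [N2 h2] := fam_bound (rep y).
by rewrite (act_conv _ h1 h2).
Qed.

Lemma gr_scale1 : left_id 1 gr_scale.
Proof.
move=> u; rewrite -[u]repK -[1]/(gr_one F) /gr_one gr_scaleE.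
by congr cls; apply/val_inj; rewrite /= act1.
Qed.

Lemma gr_scaleDr : right_distributive gr_scale +%R.
Proof.
move=> x u v; rewrite -[x]repK -[u]repK -[v]repK -clsD !gr_scaleE -clsD.
congr cls; apply/val_inj => /=.
by have [N h] := fam_bound (rep x); rewrite (actDr _ _ h).
Qed.

Lemma gr_scaleDl u : {morph gr_scale^~ u : x y / x + y}.
Proof.
move=> x y; rewrite -[x]repK -[y]repK -[u]repK -clsD !gr_scaleE -clsD.
congr cls; apply/val_inj => /=.
have [N1 h1] := fam_bound (rep x); have [N2 h2] := fam_bound (rep y).
by apply: (@actDl _ _ (maxn N1 N2)) => i h; [apply: h1|apply: h2]; lia.
Qed.

HB.instance Definition _ := GRing.Zmodule_isLmodule.Build (gr_ring F) gr_mod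
  gr_scaleA gr_scale1 gr_scaleDr gr_scaleDl.
End GradedModule.

Definition fin_gen (R : pzRingType) (X : lmodType R) : Prop :=
  exists (n : nat) (s : 'I_n -> X), forall x, exists c : 'I_n -> R,
    x = \sum_(i < n) c i *: s i.

Definition left_ideal (R : pzRingType) (I : set R) : Prop :=
  additive_subgroup I /\ forall a x, I x -> I (a * x).

Definition left_noetherian (R : pzRingType) : Prop :=
  forall I : set R, left_ideal I ->
    exists (n : nat) (s : 'I_n -> R),
      I = [set x | exists c : 'I_n -> R, x = \sum_(i < n) c i * s i].

(* The dual [Hom_R(X, R)] of a left [R]-module is the right [R]-module with
   [(f a)(x) = f(x) a]; right [R]-modules are left [R^c]-modules. *)
Section Dual.
Variables (R : pzRingType) (X : lmodType R).

Definition dual : Type := {linear X -> R^o}.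

HB.instance Definition _ := gen_eqMixin dual.
HB.instance Definition _ := gen_choiceMixin dual.

Definition dual_val (f : dual) : X -> R := (f : {linear X -> R^o}).
Coercion dual_val : dual >-> Funclass.

Lemma dualP (f g : dual) : (forall x, f x = g x) -> f = g.
Proof.
case: f => f [[hf] [kf]]; case: g => g [[hg] [kg]] /funext /= efg.
rewrite /dual_val /= in efg; case: _ / efg in hg kg *.
by rewrite (Prop_irrelevance hf hg) (Prop_irrelevance kf kg).
Qed.

Definition mk_dual (f : X -> R) (hf : linear (f : X -> R^o)) : dual :=
  HB.pack_for {linear X -> R^o} (f : X -> R^o)
    (GRing.isLinear.Build R X R^o *:%R f hf).

Lemma dual_valP (f : dual) : linear (f : X -> R^o).
Proof. by move=> a x y; rewrite /dual_val linearP. Qed.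

Lemma dual_zero_subproof : linear ((fun=> 0) : X -> R^o).
Proof. by move=> a x y; rewrite scaler0 addr0. Qed.

Lemma dual_opp_subproof (f : dual) : linear ((fun x => - f x) : X -> R^o).
Proof. by move=> a x y; rewrite dual_valP opprD scalerN. Qed.

Lemma dual_add_subproof (f g : dual) : linear ((fun x => f x + g x) : X -> R^o).
Proof. by move=> a x y; rewrite !dual_valP scalerDr addrACA. Qed.

Lemma dual_scale_subproof (a : R) (f : dual) :
  linear ((fun x => f x * a) : X -> R^o).
Proof.
move=> b x y; rewrite dual_valP -[b *: (f x * a : R^o)]/(b * (f x * a)).
by rewrite -[b *: (f x : R^o)]/(b * f x) mulrA -mulrDl.
Qed.

Definition dual_zero : dual := mk_dual dual_zero_subproof.
Definition dual_opp f : dual := mk_dual (dual_opp_subproof f).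
Definition dual_add f g : dual := mk_dual (dual_add_subproof f g).
Definition dual_scale (a : R^c) f : dual := mk_dual (dual_scale_subproof a f).

Lemma dual_addA : associative dual_add.
Proof. by move=> f g h; apply: dualP => x; exact: addrA. Qed.
Lemma dual_addC : commutative dual_add.
Proof. by move=> f g; apply: dualP => x; exact: addrC. Qed.
Lemma dual_add0 : left_id dual_zero dual_add.
Proof. by move=> f; apply: dualP => x; exact: add0r. Qed.
Lemma dual_addN : left_inverse dual_zero dual_opp dual_add.
Proof. by move=> f; apply: dualP => x; exact: addNr. Qed.

HB.instance Definition _ :=
  GRing.isZmodule.Build dual dual_addA dual_addC dual_add0 dual_addN.

Lemma dual_scaleA a b f : dual_scale a (dual_scale b f) = dual_scale (a * b) f.
Proof. by apply: dualP => x; apply/esym; exact: mulrA. Qed.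
Lemma dual_scale1 : left_id 1 dual_scale.
Proof. by move=> f; apply: dualP => x; exact: mulr1. Qed.
Lemma dual_scaleDr : right_distributive dual_scale +%R.
Proof. by move=> a f g; apply: dualP => x; exact: mulrDl. Qed.
Lemma dual_scaleDl f : {morph dual_scale^~ f : a b / a + b}.
Proof. by move=> a b; apply: dualP => x; exact: mulrDr. Qed.

HB.instance Definition _ := GRing.Zmodule_isLmodule.Build R^c dual
  dual_scaleA dual_scale1 dual_scaleDr dual_scaleDl.
End Dual.

Section Bidual.
Variables (R : pzRingType) (X : lmodType R).

Lemma eval_linear (x : X) : linear ((fun f : dual X => f x) : dual X -> R^c^o).
Proof. by []. Qed.

(* The canonical map [X -> X^**]. *)
Definition bidual_map (x : X) : dual (dual X) := mk_dual (eval_linear x).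
End Bidual.

Definition projective (R : pzRingType) (P : lmodType R) : Prop :=
  forall (A B : lmodType R) (g : {linear A -> B}) (f : {linear P -> B}),
    (forall b, exists a, g a = b) ->
    exists h : {linear P -> A}, forall x, g (h x) = f x.

Definition exact_at (R : pzRingType) (A B C : lmodType R)
    (f : {linear A -> B}) (g : {linear B -> C}) : Prop :=
  forall b, g b = 0 <-> exists a, f a = b.

(* An exact sequence [... -> C 2 -> C 1 -> C 0 -> X -> 0]. *)
Record resolution (R : pzRingType) (X : lmodType R) := Resolution {
  res :> nat -> lmodType R;
  res_d : forall i, {linear res i.+1 -> res i};
  res_aug : {linear res 0%N -> X};
  res_aug_surj : forall x, exists c, res_aug c = x;
  res_exact0 : exact_at (res_d 0) res_aug;
  res_exactS : forall i, exact_at (res_d i.+1) (res_d i) }.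

(* [Ext^k_R(X, Y) = 0], where [Ext^k_R(X, Y)] is the [k]-th cohomology group of
   the complex [Hom_R(P, Y)], for a projective resolution [P] of [X]. *)
Section Ext.
Variables (R : pzRingType) (X Y : lmodType R).

Definition cocycle (P : resolution X) (k : nat) (f : {linear P k -> Y}) : Prop :=
  forall x, f (res_d P k x) = 0.

Definition coboundary (P : resolution X) (k : nat) :
    {linear P k -> Y} -> Prop :=
  match k with
  | 0 => fun f => forall x, f x = 0
  | j.+1 => fun f => exists g : {linear P j -> Y}, forall x, f x = g (res_d P j x)
  end.

Definition Ext_eq0 (k : nat) : Prop :=
  exists P : resolution X, (forall i, projective (P i)) /\
    forall f : {linear P k -> Y}, cocycle f -> coboundary f.
End Ext.

Definition Gdim_eq0 (R : pzRingType) (X : lmodType R) : Prop :=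
  [/\ bijective (@bidual_map R X),
      forall k, (0 < k)%N -> Ext_eq0 X R^o k
    & forall k, (0 < k)%N -> Ext_eq0 (dual X) R^c^o k].

(* An exact sequence [0 -> G k -> ... -> G 0 -> X -> 0] is an infinite one
   whose terms vanish beyond [k]. *)
Definition Gdim_le (R : pzRingType) (k : nat) (X : lmodType R) : Prop :=
  if k is 0%N then Gdim_eq0 X else
  exists G : resolution X,
    (forall i, (i <= k)%N -> fin_gen (G i) /\ Gdim_eq0 (G i)) /\
    (forall i, (k < i)%N -> forall x : G i, x = 0).

Lemma Gdim_le_asbool (R : pzRingType) (X : lmodType R) :
  (exists k, Gdim_le k X) -> exists k, `[< Gdim_le k X >].
Proof. by case=> k Xk; exists k; exact/asboolP. Qed.

Definition Gdim (R : pzRingType) (X : lmodType R) : \bar int :=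
  match pselect (exists k, Gdim_le k X) with
  | left Xfin => (ex_minn (Gdim_le_asbool Xfin))%:Z%:E
  | right _ => +oo%E
  end.

(* Main.v *)
(* Let [S] be the graded ring of [L].  A good filtration of [M] gives a filtered
   presentation [0 -> K -> L^r -> M -> 0] whose graded version
   [0 -> gr K -> S^r -> gr M -> 0] is exact, and [K] is again good since [S] is
   noetherian.  If [Ext^1(gr M, S) = 0], then the symbol of a filtered linear form
   on [K] extends to [S^r]; correcting the extension degree by degree shows that
   the form itself extends to [L^r].  This yields [Ext^1(M, L) = 0] and
   [gr Hom(M, L) = Hom(gr M, S)], and along the syzygies all higher Ext vanish; so [M] has
   G-dimension zero when [gr M] does.  In general, syzygies over [S] lower the
   G-dimension, because modules of G-dimension zero are closed under extensions
   and under kernels of epimorphisms, and one concludes by induction on the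
   G-dimension of [gr M], replacing [M] by [K]. *)
From HB Require Import structures.
From mathcomp Require Import all_boot all_order all_algebra.
From mathcomp Require Import all_classical.
From mathcomp Require Import constructive_ereal.
From mathcomp Require Import zify.
Require Import Defs.

Set Implicit Arguments.
Unset Strict Implicit.
Unset Printing Implicit Defensive.

Import Order.TTheory GRing.Theory Num.Theory.

Local Open Scope classical_set_scope.
Local Open Scope ring_scope.

(** * Modules *)

Section Modules.
Variable R : pzRingType.
Implicit Types (U V W X Y K E P : lmodType R).

(** The kernel [Z] of the graded presentation and the dual of [X] are graded companions of [K] and
    of the dual of [M], but they are not literally associated graded modules of these. Hence the
    notion [grmodel]: any [S]-module with symbol maps and homogeneous projections may stand for
    [gr M], and no isomorphism has to be transported. Ext over [S] is ungraded, so an extension that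
    it supplies need not be homogeneous; the component of the required degree is extracted
    afterwards. Vanishing of Ext is phrased as the extension property [vext], which is what lifts
    along a filtration. The correction process stops because [L] has nothing in negative degrees and
    [K] is finitely generated: a form of very low degree is zero. G-dimension zero also constrains
    the dual of [M], a right module filtered by the degrees of forms, so the same results are
    applied over [L^c] and [S^c]; commutativity of [S] makes [S^c] left Noetherian. Finally, the
    biduality map of [M] has that of [X] as symbol, and bijectivity descends since filtrations are
    exhaustive and bounded below. *)

Definition mklin U V (f : U -> V) (hf : linear f) : {linear U -> V} :=
  HB.pack_for {linear U -> V} f (GRing.isLinear.Build R U V *:%R f hf).

Lemma mklinE U V (f : U -> V) (hf : linear f) x : mklin hf x = f x.
Proof. by []. Qed.

Definition surj U V (f : U -> V) : Prop := forall y, exists x, f x = y.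

Definition submodule V (A : set V) : Prop :=
  A 0 /\ forall a x y, A x -> A y -> A (a *: x + y).

Section Sub.
Variables (V : lmodType R) (A : set V) (hA : submodule A).

Definition in_submod : pred V := fun x => `[< A x >].

Lemma in_submod_closed : submod_closed in_submod.
Proof.
split; first by apply/asboolP; exact: hA.1.
by move=> a x y /asboolP Ax /asboolP Ay; apply/asboolP; exact: hA.2.
Qed.

HB.instance Definition _ :=
  GRing.isSubmodClosed.Build R V in_submod in_submod_closed.

Record submod_type := Submod { submod_val : V; _ : in_submod submod_val }.
HB.instance Definition _ := [isSub for submod_val].
HB.instance Definition _ := [Choice of submod_type by <:].
HB.instance Definition _ := [SubChoice_isSubLmodule of submod_type by <:].

Lemma submodule_ex : exists (K : lmodType R) (i : {linear K -> V}),
  injective i /\ forall x, A x <-> exists k, i k = x.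
Proof.
exists submod_type, (val : {linear submod_type -> V}); split; first exact: val_inj.
move=> x; split=> [Ax|[[y Ay] <-]]; last exact/asboolP.
by exists (Submod (asboolT Ax)).
Qed.
End Sub.

Definition ses K E X (i : {linear K -> E}) (p : {linear E -> X}) : Prop :=
  [/\ injective i, exact_at i p & surj p].

Lemma kernel_ex E X (p : {linear E -> X}) :
  exists K (i : {linear K -> E}), injective i /\ exact_at i p.
Proof.
apply: (@submodule_ex E [set x | p x = 0]).
by split=> [|a x y /= px py] /=; rewrite ?linear0 // linearP px py scaler0 addr0.
Qed.

Lemma corestrict U E K (i : {linear K -> E}) (f : {linear U -> E}) :
  injective i -> (forall u, exists k, i k = f u) ->
  exists g : {linear U -> K}, forall u, i (g u) = f u.
Proof.
move=> ii /choice[g gP].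
have gl : linear g by move=> a x y; apply: ii; rewrite linearP !gP linearP.
by exists (mklin gl).
Qed.

Lemma factor_surj U V Y (q : {linear U -> V}) (f : {linear U -> Y}) :
  surj q -> (forall u, q u = 0 -> f u = 0) ->
  exists g : {linear V -> Y}, forall u, g (q u) = f u.
Proof.
move=> /choice[s sP] qf.
have qf' u v : q u = q v -> f u = f v.
  by move=> uv; apply/eqP; rewrite -subr_eq0 -linearB qf ?linearB ?uv ?subrr.
have gl : linear (f \o s).
  by move=> a x y; rewrite /= -linearP; apply: qf'; rewrite linearP !sP.
by exists (mklin gl) => u; apply: qf'; rewrite sP.
Qed.

Lemma rV_lincomb n (x : 'rV[R]_n) : x = \sum_j x 0 j *: delta_mx 0 j.
Proof. exact: row_sum_delta. Qed.

Lemma linear_lincomb V n (s : 'I_n -> V) :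
  linear (fun x : 'rV[R]_n => \sum_j x 0 j *: s j).
Proof.
move=> a x y; rewrite scaler_sumr -big_split; apply: eq_bigr => j _ /=.
by rewrite !mxE scalerDl scalerA.
Qed.

Definition lincomb V n (s : 'I_n -> V) : {linear 'rV[R]_n -> V} :=
  mklin (linear_lincomb s).

Lemma lincombE V n (s : 'I_n -> V) x : lincomb s x = \sum_j x 0 j *: s j.
Proof. by []. Qed.

Lemma lincomb_delta V n (s : 'I_n -> V) j : lincomb s (delta_mx 0 j) = s j.
Proof.
rewrite lincombE (bigD1 j) //= big1 ?addr0 ?mxE ?eqxx ?scale1r // => k kj.
by rewrite mxE eqxx (negPf kj) scale0r.
Qed.

Lemma linear_rV V n (f : {linear 'rV[R]_n -> V}) x :
  f x = \sum_j x 0 j *: f (delta_mx 0 j).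
Proof. by rewrite {1}(rV_lincomb x) linear_sum; apply: eq_bigr => j _; rewrite linearZ. Qed.

Lemma projective_rV n : projective ('rV[R]_n).
Proof.
move=> A B g f gs; have [s sP] := choice (fun j => gs (f (delta_mx 0 j))).
exists (lincomb s) => x; rewrite linear_sum linear_rV.
by apply: eq_bigr => j _; rewrite linearZ sP.
Qed.

(* The free module on the set [X], as the functions [X -> R] with finite support. *)
Section FreeCover.
Variable X : lmodType R.

Definition fsupp : set (X -> R^o) := [set f | finite_set [set x | f x != 0]].

Lemma fsupp_submodule : submodule fsupp.
Proof.
split=> [|a f g ff fg]; rewrite /fsupp /=.
  by rewrite (_ : [set _ | _] = set0) //; apply/seteqP; split=> x //=; rewrite eqxx.
apply: (@sub_finite_set _ _ ([set x | f x != 0] `|` [set x | g x != 0])); last by rewrite finite_setU.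
move=> x /=; rewrite -[(_ + _) x]/(a * f x + g x) => h.
have [fx0|] := eqVneq (f x) 0; last by left.
by right; apply: contraNN h => /eqP ->; rewrite fx0 mulr0 addr0.
Qed.

Definition fdelta (x : X) : X -> R^o := fun y => if y == x then 1 else 0.

Lemma fsupp_delta x : fsupp (fdelta x).
Proof.
apply: (@sub_finite_set _ _ [set x]); last exact: finite_set1.
by move=> y /=; rewrite /fdelta; case: (y =P x) => // _ /eqP.
Qed.

Lemma fsupp_seq f : fsupp f -> exists s : seq X, forall x, x \notin s -> f x = 0.
Proof.
move=> /finite_seqP[s fs]; exists s => x; apply: contraNeq => fx.
by have : [set` s] x by rewrite -fs.
Qed.

Definition fsum V (h : X -> V) (f : X -> R^o) : V := \sum_(x \in [set: X]) (f x : R) *: h x.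

Lemma fsumE V (h : X -> V) f (s : seq X) : uniq s ->
  (forall x, x \notin s -> f x = 0) -> fsum h f = \sum_(x <- s) (f x : R) *: h x.
Proof.
move=> us fs; rewrite /fsum (@fsbigE _ _ _ _ _ s) //; first by apply: eq_bigl => x; rewrite in_setT.
by move=> x _ xs; rewrite fs ?scale0r.
Qed.

Lemma fsum_linear V (h : X -> V) (a : R) f g : fsupp f -> fsupp g ->
  fsum h (a *: f + g) = a *: fsum h f + fsum h g.
Proof.
move=> /fsupp_seq[s fs] /fsupp_seq[t gt]; pose st := undup (s ++ t).
have fst0 x : x \notin st -> f x = 0.
  by rewrite mem_undup mem_cat negb_or => /andP[/fs].
have gst0 x : x \notin st -> g x = 0.
  by rewrite mem_undup mem_cat negb_or => /andP[_ /gt].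
rewrite !(fsumE _ (undup_uniq (s ++ t))) //; last first.
  by move=> x xst; rewrite -[LHS]/(a * f x + g x) fst0 // gst0 // mulr0 addr0.
rewrite scaler_sumr -big_split; apply: eq_bigr => x _ /=.
by rewrite -[(a *: f + g) x]/(a * f x + g x) scalerDl scalerA.
Qed.

(** The generators are all elements of [X]: the exact sequences quantified over in [vext] involve
    arbitrary modules, so finite generation cannot be assumed. *)
Lemma free_cover : exists P (p : {linear P -> X}), projective P /\ surj p.
Proof.
have [P [i [ii iP]]] := submodule_ex fsupp_submodule.
have iw w : fsupp (i w) by apply/iP; exists w.
have hl V (h : X -> V) : linear (fun w : P => fsum h (i w)).
  by move=> a u v; rewrite linearP fsum_linear.
have [dl dlP] := choice (fun x => (iP _).1 (fsupp_delta x)).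
have fsd V (h : X -> V) x : fsum h (fdelta x) = h x.
  rewrite (@fsumE _ _ _ [:: x]) // ?big_seq1 ?/fdelta ?eqxx ?scale1r // => y.
  by rewrite inE => /negPf ->.
exists P, (mklin (hl X id)); split; last first.
  by move=> x; exists (dl x); rewrite mklinE dlP fsd.
move=> A B g f gs; have [s sP] := choice (fun x => gs (f (dl x))).
exists (mklin (hl A s)) => w; rewrite mklinE.
have /fsupp_seq[t wt] := iw w.
have wu x : x \notin undup t -> i w x = 0 by rewrite mem_undup; exact: wt.
rewrite (fsumE _ (undup_uniq t) wu) linear_sum.
(* Expansion in the basis [dl], checked by comparing values at each [y]. *)
have {2}-> : w = \sum_(x <- undup t) (i w x : R) *: dl x.
  apply: ii; rewrite linear_sum; apply/funext => y.
  rewrite fct_sumE.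
  under eq_bigr do rewrite linearZ /= dlP -[(_ *: _) y]/(_ * _) /fdelta.
  have [yt|yt] := boolP (y \in undup t).
    rewrite (bigD1_seq y) //= ?undup_uniq // eqxx mulr1 big1 ?addr0 // => x.
    by rewrite eq_sym => /negPf ->; rewrite mulr0.
  rewrite wu // big_seq big1 // => x xt; case: eqP => [xy|_]; last by rewrite mulr0.
  by rewrite -xy in xt; rewrite xt in yt.
by rewrite linear_sum; apply: eq_bigr => x _; rewrite !linearZ /= sP.
Qed.
End FreeCover.

Lemma ses_cover X : exists K P (i : {linear K -> P}) (p : {linear P -> X}),
  ses i p /\ projective P.
Proof.
have [P [p [pP ps]]] := free_cover X; have [K [i [ii ip]]] := kernel_ex p.
by exists K, P, i, p.
Qed.
End Modules.

(** * Vanishing of Ext without resolutions *)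

Section Ext.
Variable R : pzRingType.
Implicit Types (A B C D U V W X Y Z K E P T : lmodType R).

Definition extends Y K E (i : {linear K -> E}) : Prop :=
  forall f : {linear K -> Y}, exists g : {linear E -> Y}, forall x, g (i x) = f x.

(* [vext Y k X] means [Ext^(k+1)(X, Y) = 0]. *)
Fixpoint vext Y (k : nat) X : Prop :=
  if k is k'.+1 then forall K P (i : {linear K -> P}) (p : {linear P -> X}),
    ses i p -> projective P -> vext Y k' K
  else forall K E (i : {linear K -> E}) (p : {linear E -> X}),
    ses i p -> extends Y i.

(* [X'] is a retract of [X] up to maps that factor through a projective module. *)
Definition stab X' X : Prop :=
  exists T (u : {linear X' -> X}) (v : {linear X -> X'})
      (a : {linear X' -> T}) (b : {linear T -> X'}),
    projective T /\ forall x, x = v (u x) + b (a x).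

Lemma stab_refl X : stab X X.
Proof.
exists 'rV[R]_0, idfun, idfun, \0, \0; split; first exact: projective_rV.
by move=> x /=; rewrite addr0.
Qed.

Lemma ses_ker K E X (i : {linear K -> E}) (p : {linear E -> X}) : ses i p ->
  forall k, p (i k) = 0.
Proof. by case=> _ e _ k; apply/e; exists k. Qed.

(** A stable form of Schanuel's lemma. The maps lift to the covers and restrict to the kernels; the
    defect [1 - v0 u0 - b0 a p'] on [P'] takes values in [K'], so on [K'] the identity differs from
    [v1 u1] by a map through the projective [P']. With [stab_refl] it compares two syzygies of one
    module. *)
Lemma stab_syzygy K P X (i : {linear K -> P}) (p : {linear P -> X})
    K' P' X' (i' : {linear K' -> P'}) (p' : {linear P' -> X'}) :
  ses i p -> ses i' p' -> projective P -> projective P' -> stab X' X -> stab K' K.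
Proof.
move=> sp sp' pP pP' [T [u [v [a [b [pT uv]]]]]].
have [ii ip ps] := sp; have [ii' ip' ps'] := sp'.
have [u0 u0P] := pP' _ _ p (u \o p') ps.
have [v0 v0P] := pP _ _ p' (v \o p) ps'.
have [b0 b0P] := pT _ _ p' b ps'.
rewrite /= in u0P v0P b0P.
have [u1 u1P] : exists u1 : {linear K' -> K}, forall k, i (u1 k) = u0 (i' k).
  apply: (corestrict (f := u0 \o i')) => // k; apply/ip.
  by rewrite /= u0P (ses_ker sp') linear0.
have [v1 v1P] : exists v1 : {linear K -> K'}, forall k, i' (v1 k) = v0 (i k).
  apply: (corestrict (f := v0 \o i)) => // k; apply/ip'.
  by rewrite /= v0P (ses_ker sp) linear0.
have [s sP] : exists s : {linear P' -> K'},
    forall e, i' (s e) = e - v0 (u0 e) - b0 (a (p' e)).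
  apply: (corestrict (f := idfun \- (v0 \o u0) \- (b0 \o a \o p'))) => // e.
  apply/ip'; rewrite /= !linearB v0P u0P b0P /=.
  by rewrite -addrA -opprD -uv subrr.
exists P', u1, v1, i', s; split=> // k; apply: ii'.
by rewrite linearD v1P u1P sP (ses_ker sp') !linear0 addr0 addrC subrK.
Qed.

(** Syzygies reduce everything to degree 0. There an extension of [X'] is pulled back along [v] to
    an extension of [X], over which [f] extends. *)
Lemma vext_stab Y k X X' : stab X' X -> vext Y k X -> vext Y k X'.
Proof.
elim: k X X' => [|k IH] X X' st /=; last first.
  move=> vX K' P' i' p' sp' pP'; have [K [P [i [p [sp pP]]]]] := ses_cover X.
  by apply: (IH K); [exact: (stab_syzygy sp sp')|exact: (vX _ _ _ _ sp)].
move: st => [T [u [v [a [b [pT uv]]]]]] vX K E i p sp f.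
have [ii ip ps] := sp; have [b0 b0P] := pT _ _ p b ps.
(* The kernel [E'] of [D] is the fibre product of [p] and [v]. *)
pose D : {linear (E * X)%type -> X'} := (p \o fst) \- (v \o snd).
have [E' [j [ij jD]]] := kernel_ex D.
have [i' i'P] : exists i' : {linear K -> E'}, forall k, j (i' k) = (i k, 0).
  have fl : linear (fun k => (i k, 0 : X)).
    by move=> c x y; rewrite linearP; congr (_, _); rewrite /= scaler0 addr0.
  apply: (corestrict (f := mklin fl)) => // k; apply/jD.
  by rewrite /= (ses_ker sp) linear0 subrr.
have sp'' : ses i' (snd \o j : {linear E' -> X}).
  split.
  - by move=> x y xy; apply: ii; have := congr1 j xy; rewrite !i'P => -[].
  - move=> e; split=> /= [je|[k <-]]; last by rewrite i'P.
    have [k kP] : exists k, i k = (j e).1.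
      apply/ip; have /eqP : D (j e) = 0 by apply/jD; exists e.
      by rewrite /= je linear0 subr0 => /eqP.
    by exists k; apply: ij; rewrite i'P kP -je; case: (j e).
  - move=> x; have [e eP] := ps (v x).
    have [w wP] : exists w, j w = (e, x) by apply/jD; rewrite /= eP subrr.
    by exists w; rewrite /= wP.
have [g gP] := vX _ _ _ _ sp'' f.
(* The identity of [E], corrected by [b0 a p], lifts to the fibre product because
   [p e - b (a (p e)) = v (u (p e))]. *)
have [w wP] : exists w : {linear E -> E'},
    forall e, j (w e) = (e - b0 (a (p e)), u (p e)).
  have wl : linear (fun e => (e - b0 (a (p e)), u (p e))).
    move=> c x y; congr (_, _); rewrite /= (linearP p) ?(linearP u) //.
    by rewrite (linearP a) (linearP b0) opprD addrACA scalerBr.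
  apply: (corestrict (f := mklin wl)) => // e; apply/jD.
  by rewrite /= linearB b0P {1}(uv (p e)) addrK subrr.
exists (g \o w) => k /=; rewrite -gP; congr (g _); apply: ij.
by rewrite wP i'P (ses_ker sp) !linear0 addr0.
Qed.

(** In positive degree [vext] quantifies over all projective covers; since syzygies are unique up to
    [stab], a single one suffices. *)
Lemma vext_shift Y k K P X (i : {linear K -> P}) (p : {linear P -> X}) :
  ses i p -> projective P -> vext Y k K -> vext Y k.+1 X.
Proof.
move=> sp pP vK K' P' i' p' sp' pP'; apply: vext_stab vK.
exact: (stab_syzygy sp sp' pP pP' (stab_refl X)).
Qed.

(** Any extension [E] of [X] by [K'] is the pushout of [i] along [w1], a quotient of [P * K']. So
    [f] only has to be combined with an extension of [f w1] to [P]. *)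
Lemma vext_one Y K P X (i : {linear K -> P}) (p : {linear P -> X}) :
  ses i p -> projective P -> extends Y i -> vext Y 0 X.
Proof.
move=> sp pP eK K' E i' p' sp' f.
have [ii ip ps] := sp; have [ii' ip' ps'] := sp'.
have [w wP] := pP _ _ p' p ps'.
have [w1 w1P] : exists w1 : {linear K -> K'}, forall k, i' (w1 k) = w (i k).
  apply: (corestrict (f := w \o i)) => // k; apply/ip'.
  by rewrite /= wP (ses_ker sp).
have [g gP] := eK (f \o w1).
pose q : {linear (P * K')%type -> E} := (w \o fst) \+ (i' \o snd).
pose h : {linear (P * K')%type -> Y} := (g \o fst) \+ (f \o snd).
have [h' h'P] : exists h' : {linear E -> Y}, forall z, h' (q z) = h z.
  apply: factor_surj => [e|[x k]] /=.
    have [x xP] := ps (p' e).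
    have [k kP] : exists k, i' k = e - w x by apply/ip'; rewrite linearB wP xP subrr.
    by exists (x, k); rewrite /= kP addrC subrK.
  (* The kernel of [q] consists of the pairs [(i k', - w1 k')], on which [h] vanishes by the choice
     of [g]. *)
  move=> wk; have [k' k'P] : exists k', i k' = x.
    apply/ip; have := congr1 p' wk.
    by rewrite linearD wP (ses_ker sp') addr0 linear0.
  rewrite -k'P gP /= -linearD (_ : w1 k' + k = 0) ?linear0 //.
  by apply: ii'; rewrite linearD w1P k'P wk linear0.
exists h' => k; have := h'P (0, k).
by rewrite /q /h /= !linear0 !add0r.
Qed.

Lemma projective_retraction K E P (i : {linear K -> E}) (p : {linear E -> P}) :
  ses i p -> projective P -> exists r : {linear E -> K}, forall k, r (i k) = k.
Proof.
move=> sp pP; have [ii ip ps] := sp.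
have [s sP] := pP _ _ p idfun ps; rewrite /= in sP.
have [r rP] : exists r : {linear E -> K}, forall e, i (r e) = e - s (p e).
  apply: (corestrict (f := idfun \- (s \o p))) => // e; apply/ip.
  by rewrite /= linearB sP subrr.
by exists r => k; apply: ii; rewrite rP (ses_ker sp) linear0 subr0.
Qed.

Lemma vext_projective Y k P : projective P -> vext Y k P.
Proof.
elim: k P => [|k IH] P pP K E i p sp => [f|pE];
  have [r rP] := projective_retraction sp pP.
  by exists (f \o r) => k; rewrite /= rP.
(* [K] is a retract of the projective [E], so it is projective as well. *)
apply: IH => A B g f gs; have [h hP] := pE _ _ g (f \o r) gs.
by exists (h \o i) => x; rewrite /= hP /= rP.
Qed.

(** * The long exact sequence of Ext, as implications between vanishing statements *)

Section LongExact.
Variable Y : lmodType R.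

(** [D] is the preimage of [A] in [P]. For projective [P], the sequence [A -> B -> C] is traded for
    [K -> D -> A], where [K] and [D] are syzygies of [B] and [C]: one rotation of the long exact
    sequence. *)
Lemma rotate A B C P K (i : {linear A -> B}) (p : {linear B -> C})
    (j : {linear K -> P}) (q : {linear P -> B}) :
  ses i p -> ses j q ->
  exists (D : lmodType R) (j' : {linear D -> P}) (a : {linear K -> D}) (b : {linear D -> A}),
    [/\ ses j' (p \o q : {linear P -> C}), ses a b, forall k, j' (a k) = j k
      & forall d, i (b d) = q (j' d)].
Proof.
move=> sp sq; have [ii ip ps] := sp; have [ij jq qs] := sq.
have [D [j' [ij' j'P]]] := kernel_ex (p \o q : {linear P -> C}).
have [a aP] : exists a : {linear K -> D}, forall k, j' (a k) = j k.
  by apply: corestrict => // k; apply/j'P; rewrite /= (ses_ker sq) linear0.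
have [b bP] : exists b : {linear D -> A}, forall d, i (b d) = q (j' d).
  by apply: (corestrict (f := q \o j')) => // d; apply/ip/(j'P _).2; exists d.
exists D, j', a, b; split=> //; split=> //.
- by move=> c; have [y <-] := ps c; have [x <-] := qs y; exists x.
- by move=> x y xy; apply: ij; rewrite -!aP xy.
- move=> d; split=> [bd|[k <-]].
    have [k kP] : exists k, j k = j' d by apply/jq; rewrite -bP bd linear0.
    by exists k; apply: ij'; rewrite aP.
  by apply: ii; rewrite bP aP (ses_ker sq) linear0.
- move=> x; have [z zP] := qs (i x).
  have [d dP] : exists d, j' d = z by apply/j'P; rewrite /= zP (ses_ker sp).
  by exists d; apply: ii; rewrite bP dP.
Qed.

(** A map on [K] extends in two steps along [K], [D], [E], whose successive quotients are [A] and
    [C]. *)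
Lemma vext0_mid A B C (i : {linear A -> B}) (p : {linear B -> C}) :
  ses i p -> vext Y 0 A -> vext Y 0 C -> vext Y 0 B.
Proof.
move=> sp vA vC K E j q sq f.
have [D [j' [a [b [s1 s2 aj bj]]]]] := rotate sp sq.
have [g gP] := vA _ _ _ _ s2 f; have [h hP] := vC _ _ _ _ s1 g.
by exists h => x; rewrite -aj hP gP.
Qed.

(** The restriction of [f] to [K] extends over [P]; subtracting this extension leaves a map on [D]
    that factors through [A], hence extends to [B] and pulls back to [P]. *)
Lemma vext0_right A B C (i : {linear A -> B}) (p : {linear B -> C}) :
  ses i p -> extends Y i -> vext Y 0 B -> vext Y 0 C.
Proof.
move=> sp eA vB; have [K [P [j [q [sq pP]]]]] := ses_cover B.
have [D [j' [a [b [s1 s2 aj bj]]]]] := rotate sp sq.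
apply: (vext_one s1 pP) => f.
have [g gP] := vB _ _ _ _ sq (f \o a).
have [_ ab bs] := s2.
have [h hP] : exists h : {linear A -> Y}, forall d, h (b d) = f d - g (j' d).
  apply: (factor_surj (f := f \- (g \o j'))) => // d /ab[k <-] /=.
  by rewrite aj gP subrr.
have [h' h'P] := eA h.
by exists (g \+ (h' \o q)) => d /=; rewrite -bj h'P hP addrC subrK.
Qed.

(** The two implications need a joint induction: one rotation derives the first in degree [k + 1]
    from the second in degree [k], and two rotations derive the second in degree [k + 1] from the
    first in degree [k]. *)
Lemma vext_left_mid k :
  (forall A B C (i : {linear A -> B}) (p : {linear B -> C}), ses i p ->
     vext Y k A -> vext Y k C -> vext Y k B) /\
  (forall A B C (i : {linear A -> B}) (p : {linear B -> C}), ses i p ->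
     vext Y k B -> vext Y k.+1 C -> vext Y k A).
Proof.
elim: k => [|k [mid left]].
  split=> A B C i p sp; first exact: vext0_mid sp.
  move=> vB vC; have [K [P [j [q [sq pP]]]]] := ses_cover B.
  have [D [j' [a [b [s1 s2 aj bj]]]]] := rotate sp sq.
  apply: (vext0_right s2) (vC _ _ _ _ s1 pP) => f.
  have [g gP] := vB _ _ _ _ sq f.
  by exists (g \o j') => x; rewrite /= aj gP.
have mid' A B C (i : {linear A -> B}) (p : {linear B -> C}) : ses i p ->
    vext Y k.+1 A -> vext Y k.+1 C -> vext Y k.+1 B.
  move=> sp vA vC; have [K [P [j [q [sq pP]]]]] := ses_cover B.
  have [D [j' [a [b [s1 s2 aj bj]]]]] := rotate sp sq.
  by apply: (vext_shift sq pP); apply: (left _ _ _ _ _ s2) vA; exact: vC s1 pP.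
split=> // A B C i p sp vB vC; have [K [P [j [q [sq pP]]]]] := ses_cover B.
have [D [j' [a [b [s1 s2 aj bj]]]]] := rotate sp sq.
have [K' [P' [j2 [q' [sq' pP']]]]] := ses_cover D.
have [D' [j3 [a' [b' [s1' s2' aj' bj']]]]] := rotate s2 sq'.
apply: (vext_shift s1' pP').
apply: (mid _ _ _ _ _ s2'); last exact: (vB _ _ _ _ sq pP).
exact: (vC _ _ _ _ s1 pP) sq' pP'.
Qed.

Lemma vext_mid k A B C (i : {linear A -> B}) (p : {linear B -> C}) :
  ses i p -> vext Y k A -> vext Y k C -> vext Y k B.
Proof. by have [h _] := vext_left_mid k; exact: h. Qed.

Lemma vext_left k A B C (i : {linear A -> B}) (p : {linear B -> C}) :
  ses i p -> vext Y k B -> vext Y k.+1 C -> vext Y k A.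
Proof. by have [_ h] := vext_left_mid k; exact: h. Qed.

Lemma vext_right k A B C (i : {linear A -> B}) (p : {linear B -> C}) :
  ses i p -> vext Y k A -> vext Y k.+1 B -> vext Y k.+1 C.
Proof.
move=> sp vA vB; have [K [P [j [q [sq pP]]]]] := ses_cover B.
have [D [j' [a [b [s1 s2 aj bj]]]]] := rotate sp sq.
apply: (vext_shift s1 pP).
by apply: (vext_mid s2) vA; exact: vB sq pP.
Qed.
End LongExact.

(** * Agreement of [vext] with Ext computed by resolutions *)

(** Dimension shifting: [Q] is the tail of [P], a resolution of the first syzygy. The transfer of
    cocycles holds by computation, so it is recorded before [Q] becomes opaque. In degree 1 a
    cocycle is a map on [K], and it bounds when it extends to [P 0]. *)
Lemma resolution_shift X (P : resolution X) :
  exists K (i : {linear K -> P 0%N}) (Q : resolution K),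
    [/\ ses i (res_aug P), (forall n, Q n = P n.+1),
     (forall Y (k : nat), (forall f : {linear P k.+2 -> Y}, cocycle f -> coboundary f) ->
        forall f : {linear Q k.+1 -> Y}, cocycle f -> coboundary f),
     (forall Y (k : nat), (forall f : {linear Q k.+1 -> Y}, cocycle f -> coboundary f) ->
        forall f : {linear P k.+2 -> Y}, cocycle f -> coboundary f) &
     (forall Y, (forall f : {linear P 1%N -> Y}, cocycle f -> coboundary f) <->
        extends Y i)].
Proof.
have [K [i [ii ip]]] := kernel_ex (res_aug P).
have [a aP] : exists a : {linear P 1%N -> K}, forall x, i (a x) = res_d P 0 x.
  by apply: corestrict => // x; apply/ip/res_exact0; exists x.
have as_ : surj a.
  move=> k; have [x xP] : exists x, res_d P 0 x = i k.
    by apply/res_exact0/ip; exists k.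
  by exists x; apply: ii; rewrite aP.
have ax : exact_at (res_d P 1) a.
  move=> b; split=> [ab|[c <-]].
    by apply/res_exactS; rewrite -aP ab linear0.
  by apply: ii; rewrite aP linear0; apply/res_exactS; exists c.
pose Q := @Resolution R K (fun n => P n.+1) (fun n => res_d P n.+1) a as_ ax
  (fun n => @res_exactS R X P n.+1).
exists K, i, Q; split=> //; first by split=> //; exact: res_aug_surj.
move=> Y; split=> [h f|h f cf].
  have [x|g gP] := h (f \o a).
    by rewrite /= (_ : a _ = 0) ?linear0 //; apply/ax; exists x.
  by exists g => k; have [x <-] := as_ k; rewrite aP -gP.
have [f' f'P] : exists f' : {linear K -> Y}, forall x, f' (a x) = f x.
  by apply: factor_surj => // x /ax[c <-]; exact: cf.
by have [g gP] := h f'; exists g => x; rewrite -aP gP f'P.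
Qed.

Lemma Ext_eq0_vext Y k X : Ext_eq0 X Y k.+1 -> vext Y k X.
Proof.
case=> P [pP]; elim: k X P pP => [|k IH] X P pP; have
  [K [i [Q [si QP cQ _ P1]]]] := resolution_shift P.
  by move=> /P1; exact: (vext_one si).
move=> /cQ vQ; apply: (vext_shift si) => //; apply: (IH K Q) => // n.
by rewrite QP.
Qed.

Lemma resolution_ex X : exists P : resolution X, forall n, projective (P n).
Proof.
(* A cover is selected for every module at once, as data, so that syzygies can be iterated. *)
have cov Z : {K : lmodType R & {P : lmodType R & {i : {linear K -> P} &
    {p : {linear P -> Z} | ses i p /\ projective P}}}}.
  have /cid[K /cid[P /cid[i /cid[p h]]]] := ses_cover Z.
  by exists K, P, i, p.
pose K Z := projT1 (cov Z); pose P Z := projT1 (projT2 (cov Z)).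
pose i Z : {linear K Z -> P Z} := projT1 (projT2 (projT2 (cov Z))).
pose p Z : {linear P Z -> Z} := sval (projT2 (projT2 (projT2 (cov Z)))).
have covP Z : ses (i Z) (p Z) /\ projective (P Z).
  exact: (svalP (projT2 (projT2 (projT2 (cov Z))))).
pose S := fix S n := if n is n'.+1 then K (S n') else X.
have e n : exact_at (i (S n) \o p (S n.+1) : {linear P (S n.+1) -> P (S n)}) (p (S n)).
  have [[_ ip _] _] := covP (S n); have [[_ _ ps] _] := covP (S n.+1).
  move=> b; split=> [/ip[k <-]|[a <-]]; last by apply/ip; exists (p (S n.+1) a).
  by have [a aP] := ps k; exists a; rewrite /= aP.
have eS n : exact_at (i (S n.+1) \o p (S n.+2) : {linear P (S n.+2) -> P (S n.+1)})
    (i (S n) \o p (S n.+1) : {linear P (S n.+1) -> P (S n)}).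
  move=> b; rewrite -e; split=> [|pb] /=; last by rewrite pb linear0.
  by have [[ii _ _] _] := covP (S n); rewrite -(linear0 (i (S n))) => /ii.
have [[_ _ p0] _] := covP X.
exists (@Resolution R X (fun n => P (S n)) (fun n => i (S n) \o p (S n.+1))
  (p X) p0 (e 0%N) eS) => n /=.
by have [] := covP (S n).
Qed.

Lemma vext_Ext_eq0 Y k X : vext Y k X -> Ext_eq0 X Y k.+1.
Proof.
have [P pP] := resolution_ex X; move=> vX; exists P; split=> //; move: vX; elim: k X P pP => [|k IH] X P pP; have
  [K [i [Q [si QP _ cQ P1]]]] := resolution_shift P.
  by move=> vX; apply/P1; exact: vX si.
move=> vX; apply: cQ; apply: IH => [n|]; first by rewrite QP.
exact: vX si (pP _).
Qed.
End Ext.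

(** * Modules of G-dimension zero *)

Lemma bijectiveP (U V : Type) (f : U -> V) :
  bijective f <-> injective f /\ forall y, exists x, f x = y.
Proof.
split=> [[g fK gK]|[fi /choice[g gP]]].
  by split=> [|y]; [exact: can_inj fK|exists (g y)].
by exists g => // x; apply: fi; rewrite gP.
Qed.

Section Duality.
Variable R : pzRingType.
Implicit Types (A B C G K X Y Z : lmodType R).

Lemma dualE X (f : X -> R) (hf : linear (f : X -> R^o)) x : mk_dual hf x = f x.
Proof. by []. Qed.

Lemma dual_val_lin X (f : dual X) (a : R) x y : f (a *: x + y) = a * f x + f y.
Proof. by rewrite dual_valP. Qed.

Lemma dual_val0 X (f : dual X) : f 0 = 0.
Proof. exact: (linear0 (f : {linear X -> R^o})). Qed.

Lemma dual_valD X (f : dual X) x y : f (x + y) = f x + f y.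
Proof. exact: (linearD (f : {linear X -> R^o})). Qed.

Lemma dual_valB X (f : dual X) x y : f (x - y) = f x - f y.
Proof. exact: (linearB (f : {linear X -> R^o})). Qed.

Lemma dual_valZ X (f : dual X) (a : R) x : f (a *: x) = a * f x.
Proof. exact: (linearZ_LR (f : {linear X -> R^o})). Qed.

Section Dmap.
Variables (X Y : lmodType R) (p : {linear X -> Y}).

Lemma dmap_subproof (f : dual Y) : linear ((fun x => f (p x)) : X -> R^o).
Proof. by move=> a x y; rewrite linearP dual_val_lin. Qed.

Lemma dmap_linear : linear (fun f : dual Y => mk_dual (dmap_subproof f) : dual X).
Proof. by move=> a f g; apply: dualP. Qed.

Definition dmap : {linear dual Y -> dual X} := mklin dmap_linear.

End Dmap.

(** Left exactness of Hom gives everything but the surjectivity of [dmap i], which is the hypothesis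
    [extends]. *)
Lemma ses_dual A B C (i : {linear A -> B}) (p : {linear B -> C}) :
  ses i p -> extends R^o i -> ses (dmap p) (dmap i).
Proof.
move=> sp ei; have [ii ip ps] := sp; split.
- move=> f g fg; apply: dualP => x; have [y <-] := ps x.
  exact: (congr1 (fun h : dual B => h y) fg).
- move=> f; split=> [fi|[g <-]]; last first.
    apply: dualP => x; rewrite -[LHS]/(g (p (i x))) (ses_ker sp).
    exact: dual_val0.
  have [g gP] : exists g : {linear C -> R^o}, forall x, g (p x) = f x.
    apply: (factor_surj (f := (f : {linear B -> R^o}))) => // x /ip[y <-].
    exact: (congr1 (fun h : dual A => h y) fi).
  by exists (g : dual C); apply: dualP => x; exact: gP.
- move=> f; have [g gP] := ei (f : {linear A -> R^o}).
  by exists (g : dual B); apply: dualP => x; exact: gP.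
Qed.

End Duality.

Section Gdim0.
Variable R : pzRingType.
Implicit Types (A B C G K X Y Z : lmodType R).

Definition gdim0 X : Prop :=
  [/\ bijective (@bidual_map R X), forall k, vext R^o k X
    & forall k, vext R^c^o k (dual X)].

Lemma Gdim_eq0P X : Gdim_eq0 X <-> gdim0 X.
Proof.
split=> -[h1 h2 h3]; split=> // k.
- by apply: Ext_eq0_vext; exact: h2.
- by apply: Ext_eq0_vext; exact: h3.
- by case: k => // k _; apply: vext_Ext_eq0.
- by case: k => // k _; apply: vext_Ext_eq0.
Qed.

(** The dual sequence [0 -> C^* -> B^* -> A^* -> 0] is exact, and the vanishing for [A^*] is read
    off from it. Only Ext^1 needs more, namely that [B^** -> C^**] is onto; this holds because [C]
    is reflexive and [p] is onto. *)
Lemma gdim0_left A B C (i : {linear A -> B}) (p : {linear B -> C}) :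
  ses i p -> gdim0 B -> gdim0 C -> gdim0 A.
Proof.
move=> sp [/bijectiveP[bBi bBs] vB vB'] [/bijectiveP[bCi bCs] vC vC'].
have vA k : vext R^o k A by exact: vext_left sp _ _.
have sd := ses_dual sp (vC 0%N _ _ _ _ sp).
have [ii ip ps] := sp; have [di dip ds] := sd.
have ev_surj : extends R^c^o (dmap p).
  move=> f; have [c cP] := bCs (f : dual (dual C)); have [b bc] := ps c.
  exists (bidual_map b : {linear dual B -> R^c^o}) => g.
  by rewrite -[LHS]/(g (p b)) bc -[LHS]/(bidual_map c g) cP.
split=> //.
- apply/bijectiveP; split=> [x y xy|f].
    apply/ii/bBi/dualP => g.
    exact: (congr1 (fun h : dual (dual A) => h (dmap i g)) xy).
  have [b bP] := bBs (dmap (dmap i) f).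
  have [a ab] : exists a, i a = b.
    apply/ip/bCi/dualP => g; rewrite -[LHS]/(bidual_map b (dmap p g)) bP.
    rewrite -[LHS]/(f (dmap i (dmap p g))) (ses_ker sd) dual_val0.
    exact: (esym (dual_val0 g)).
  exists a; apply: dualP => g; have [h <-] := ds g.
  by rewrite -[RHS]/(dmap (dmap i) f h) -bP -ab.
- move=> [|k]; first exact: vext0_right sd _ _.
  exact: vext_right sd _ _.
Qed.

(** Reflexivity is the chase of the five lemma: modulo evaluation at some [b], an element of [B^**]
    kills [C^*], so it comes from [A^**]. *)
Lemma gdim0_mid A B C (i : {linear A -> B}) (p : {linear B -> C}) :
  ses i p -> gdim0 A -> gdim0 C -> gdim0 B.
Proof.
move=> sp [/bijectiveP[bAi bAs] vA vA'] [/bijectiveP[bCi bCs] vC vC'].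
have sd := ses_dual sp (vC 0%N _ _ _ _ sp).
have [ii ip ps] := sp; have [di dip ds] := sd.
split=> [|k|k]; [|exact: vext_mid sp _ _|exact: vext_mid sd _ _].
apply/bijectiveP; split=> [x y xy|f].
  apply/eqP; rewrite -subr_eq0; apply/eqP.
  have xy0 g : dual_val g (x - y) = 0.
    rewrite dual_valB; apply/eqP; rewrite subr_eq0; apply/eqP.
    exact: (congr1 (fun h : dual (dual B) => h g) xy).
  have [a ai] : exists a, i a = x - y.
    apply/ip/bCi/dualP => g.
    exact: (etrans (xy0 (dmap p g)) (esym (dual_val0 g))).
  rewrite -ai; suff -> : a = 0 by rewrite linear0.
  apply/bAi/dualP => g; have [h <-] := ds g.
  apply: (etrans _ (esym (dual_val0 (dmap i h)))).
  by rewrite -[LHS]/(dual_val h (i a)) ai; exact: xy0.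
have [c cP] := bCs (dmap (dmap p) f); have [b bc] := ps c.
pose f' : dual (dual B) := f - bidual_map b.
have f'p g : f' (dmap p g) = 0.
  rewrite -[LHS]/(dmap (dmap p) f g - g (p b)) -cP bc.
  by rewrite -[X in X - _]/(g c) subrr.
have [g gP] : exists g : {linear dual A -> R^c^o}, forall h, g (dmap i h) = f' h.
  apply: (factor_surj (f := (f' : {linear dual B -> R^c^o}))) => // h.
  by move=> /dip[h' <-]; exact: f'p.
have [a aP] := bAs (g : dual (dual A)).
exists (i a + b); apply: dualP => h; rewrite -[LHS]/(dual_val h (i a + b)) dual_valD.
rewrite -[X in X + _]/(bidual_map a (dmap i h)) aP -[X in X + _]/(g (dmap i h)) gP.
by rewrite -[X in X + _]/(f h - h b) subrK.
Qed.

Lemma dual_rV n : exists u : {linear 'rV[R^c]_n -> dual 'rV[R]_n},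
  [/\ injective u, surj u & forall y x, u y x = \sum_j x 0 j * (y 0 j : R)].
Proof.
have ul (y : 'rV[R^c]_n) :
    linear ((fun x : 'rV[R]_n => \sum_j x 0 j * (y 0 j : R)) : _ -> R^o).
  move=> a x z; rewrite scaler_sumr -big_split; apply: eq_bigr => j _.
  by rewrite !mxE mulrDl -[_ *: _]/(_ * _) mulrA.
have ul' : linear (fun y => mk_dual (ul y) : dual 'rV[R]_n).
  move=> a y z; apply: dualP => x.
  rewrite -[LHS]/(\sum_j x 0 j * ((a *: y + z) 0 j : R)).
  rewrite -[RHS]/((\sum_j x 0 j * (y 0 j : R)) * (a : R) + \sum_j x 0 j * (z 0 j : R)).
  rewrite mulr_suml -big_split.
  by apply: eq_bigr => j _; rewrite !mxE -mulrA /= -mulrDr.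
exists (mklin ul'); split=> //.
- move=> y z yz; apply/rowP => j.
  have := congr1 (fun f : dual 'rV[R]_n => f (delta_mx 0 j)) yz; rewrite !dualE.
  rewrite !(bigD1 (P := predT) j) //= !big1 ?addr0; first by rewrite !mxE !eqxx !mul1r.
  - by move=> k kj; rewrite mxE eqxx (negPf kj) mul0r.
  - by move=> k kj; rewrite mxE eqxx (negPf kj) mul0r.
- move=> f; exists (\row_j (f (delta_mx 0 j) : R^c)); apply: dualP => x; rewrite dualE.
  rewrite -[RHS]/((f : {linear 'rV[R]_n -> R^o}) x) linear_rV.
  by apply: eq_bigr => j _; rewrite mxE.
Qed.

Lemma projective_iso (S : pzRingType) (P Q : lmodType S) (u : {linear P -> Q}) :
  injective u -> surj u -> projective P -> projective Q.
Proof.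
move=> ui us pP A B g f gs.
have [v vP] : exists v : {linear Q -> P}, forall x, u (v x) = x.
  by apply: (corestrict (f := idfun)) => // x; exact: us.
have [h hP] := pP _ _ g (f \o u) gs.
by exists (h \o v) => x; rewrite /= hP /= vP.
Qed.

Lemma gdim0_rV n : gdim0 'rV[R]_n.
Proof.
have [u [ui us uE]] := dual_rV n; split=> [|k|k].
- apply/bijectiveP; split=> [x y xy|f].
    apply/rowP => j.
    have ev z : bidual_map z (u (delta_mx 0 j)) = z 0 j.
      rewrite -[LHS]/(u (delta_mx 0 j) z) uE (bigD1 j) //= big1 ?addr0.
        by rewrite mxE !eqxx mulr1.
      by move=> k kj; rewrite mxE eqxx (negPf kj) mulr0.
    by rewrite -!ev xy.
  exists (\row_j (f (u (delta_mx 0 j)) : R)); apply: dualP => g.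
  have [y <-] := us g; rewrite -[LHS]/(u y _) uE.
  rewrite -[RHS]/((f : {linear dual 'rV[R]_n -> R^c^o}) (u y)).
  rewrite -[RHS]/((f \o u : {linear 'rV[R^c]_n -> R^c^o}) y) linear_rV.
  by apply: eq_bigr => j _; rewrite mxE.
- exact/vext_projective/projective_rV.
- exact/vext_projective/(projective_iso ui us)/projective_rV.
Qed.

(** An isomorphism is the kernel of the map to the zero module, so [gdim0_left] applies. *)
Lemma gdim0_iso X Y (u : {linear X -> Y}) : injective u -> surj u ->
  gdim0 Y -> gdim0 X.
Proof.
move=> ui us gY.
have s0 : ses u (\0 : {linear Y -> 'rV[R]_0}).
  by split=> // y; exists 0; apply/rowP => -[].
exact: (gdim0_left s0 gY (gdim0_rV 0)).
Qed.
End Gdim0.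

(** * Noetherian modules *)

Section Noetherian.
Variable R : pzRingType.
Implicit Types (A B C D E K X Y Z V : lmodType R).

Lemma fin_genP X : fin_gen X <-> exists n (p : {linear 'rV[R]_n -> X}), surj p.
Proof.
split=> -[n] [s sP]; exists n.
  exists (lincomb s) => x; have [c ->] := sP x.
  by exists (\row_i c i); rewrite lincombE; apply: eq_bigr => i _; rewrite mxE.
exists (fun i => s (delta_mx 0 i)) => x; have [c <-] := sP x.
by exists (c 0); exact: linear_rV.
Qed.

Lemma fin_gen_surj X Y (p : {linear X -> Y}) : surj p -> fin_gen X -> fin_gen Y.
Proof.
move=> ps /fin_genP[n [q qs]]; apply/fin_genP; exists n, (p \o q) => y.
by have [x <-] := ps y; have [z <-] := qs x; exists z.
Qed.

Lemma fin_gen_rV n : fin_gen 'rV[R]_n.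
Proof. by apply/fin_genP; exists n, idfun => x; exists x. Qed.

Lemma fin_gen_trivial X : (forall x : X, x = 0) -> fin_gen X.
Proof. by move=> X0; exists 0%N, (fun=> 0) => x; exists (fun=> 0); rewrite big_ord0. Qed.

Lemma fin_gen_mid A B C (i : {linear A -> B}) (p : {linear B -> C}) :
  ses i p -> fin_gen A -> fin_gen C -> fin_gen B.
Proof.
move=> [ii ip ps] /fin_genP[m [f fs]] /fin_genP[n [g gs]]; apply/fin_genP.
have [h hP] := projective_rV g ps.
exists (m + n)%N, ((i \o f \o lsubmx) \+ (h \o rsubmx)) => b.
have [y yP] := gs (p b).
have [a aP] : exists a, i a = b - h y by apply/ip; rewrite linearB hP yP subrr.
have [x xP] := fs a; exists (row_mx x y).
by rewrite /= row_mxKl row_mxKr xP aP subrK.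
Qed.

Definition noeth V : Prop :=
  forall K (i : {linear K -> V}), injective i -> fin_gen K.

Lemma image_ex X Y (f : {linear X -> Y}) :
  exists D (p : {linear X -> D}) (i : {linear D -> Y}),
    [/\ surj p, injective i & forall x, i (p x) = f x].
Proof.
have [|D [i [ii iP]]] := @submodule_ex R Y (range f).
  split=> [|a _ _ [x _ <-] [y _ <-]]; first by exists 0; rewrite ?linear0.
  by exists (a *: x + y); rewrite ?linearP.
have [p pP] : exists p : {linear X -> D}, forall x, i (p x) = f x.
  by apply: corestrict => // x; apply/iP; exists x.
exists D, p, i; split=> // d.
have [x _ xd] : range f (i d) by apply/iP; exists d.
by exists x; apply: ii; rewrite pP.
Qed.

Lemma noeth_mid A B C (i : {linear A -> B}) (p : {linear B -> C}) :
  ses i p -> noeth A -> noeth C -> noeth B.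
Proof.
move=> [ii ip ps] nA nC K j ij.
have [D [q [d [qs id qd]]]] := image_ex (p \o j : {linear K -> C}).
have [K' [k [ik kq]]] := kernel_ex q.
have [a aP] : exists a : {linear K' -> A}, forall x, i (a x) = j (k x).
  apply: (corestrict (f := j \o k)) => // x; apply/ip.
  have /kq kx : exists y, k y = k x by exists x.
  by move: (qd (k x)); rewrite kx linear0.
apply: (fin_gen_mid (i := k) (p := q)) => //; last exact: nC id.
apply: nA (a) _ => x y xy; apply/ik/ij; by rewrite -!aP xy.
Qed.

Lemma noeth_surj E X (p : {linear E -> X}) : surj p -> noeth E -> noeth X.
Proof.
move=> ps nE K j ij.
have [|A [i [ii iP]]] := @submodule_ex R E [set e | exists k, j k = p e].
  split=> [|a x y [k kx] [l ly]]; first by exists 0; rewrite !linear0.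
  by exists (a *: k + l); rewrite !linearP kx ly.
have [q qP] : exists q : {linear A -> K}, forall x, j (q x) = p (i x).
  by apply: (corestrict (f := p \o i)) => // x; apply/iP; exists x.
apply: (fin_gen_surj (p := q)); last exact: nE ii.
move=> k; have [e eP] := ps (j k).
have [x xe] : exists x, i x = e by apply/iP; exists k.
by exists x; apply: ij; rewrite qP xe.
Qed.

Hypothesis R_noeth : left_noetherian R.

Lemma noeth_regular : noeth R^o.
Proof.
move=> K i ii; have [|n [s sP]] := R_noeth (I := range i).
  split; last by move=> a _ [x _ <-]; exists (a *: x); rewrite ?linearZ.
  split=> [|_ _ [x _ <-] [y _ <-]]; first by exists 0; rewrite ?linear0.
  by exists (x - y); rewrite ?linearB.
have /choice[t tP] : forall j, exists k, i k = s j.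
  move=> j; have [k _ <-] : range i (s j); last by exists k.
  rewrite sP; exists (fun l => if l == j then 1 else 0).
  rewrite (bigD1 j) //= big1 ?eqxx ?mul1r ?addr0 // => l /negPf ->.
  by rewrite mul0r.
exists n, t => x; have : range i (i x) by exists x.
rewrite sP => -[c xc]; exists c; apply: ii; rewrite xc linear_sum.
by apply: eq_bigr => j _; rewrite linearZ /= tP.
Qed.

Lemma noeth_rV n : noeth 'rV[R]_n.
Proof.
elim: n => [|n IH].
  move=> K i ii; apply: fin_gen_trivial => x; apply: ii.
  by apply/rowP => -[].
pose i : {linear 'rV[R]_n -> 'rV[R]_n.+1} := lincomb (fun j => delta_mx 0 (lift ord0 j)).
have pl : linear (fun x : 'rV[R]_n.+1 => x 0 0 : R^o) by move=> a x y; rewrite !mxE.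
have i0 x : i x 0 0 = 0.
  rewrite lincombE summxE big1 // => j _; rewrite !mxE eqxx.
  by rewrite (negPf (neq_lift _ _)) mulr0.
have iS x j : i x 0 (lift ord0 j) = x 0 j.
  rewrite lincombE summxE (bigD1 j) //= big1 ?addr0 ?mxE ?eqxx ?mulr1 ?mxE ?eqxx ?mulr1 //.
  by move=> k /negPf kj; rewrite !mxE eqxx (inj_eq lift_inj) eq_sym kj mulr0.
apply: (noeth_mid (i := i) (p := mklin pl)) => //; last exact: noeth_regular.
split.
- by move=> x y xy; apply/rowP => j; rewrite -!iS xy.
- move=> x; split=> [|[y <-]]; last exact: i0.
  rewrite mklinE => x0; exists (\row_j x 0 (lift ord0 j)); apply/rowP => j.
  by case: (unliftP ord0 j) => [k|] ->; rewrite ?i0 ?iS ?mxE.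
- by move=> a; exists (a *: delta_mx 0 0); rewrite mklinE !mxE !eqxx mulr1.
Qed.

Lemma noeth_fin_gen X : fin_gen X -> noeth X.
Proof. by move=> /fin_genP[n [p ps]]; apply: noeth_surj ps _; exact: noeth_rV. Qed.
End Noetherian.

(** A surjection from a free module of rank [n] onto [X] embeds [dual X] into a free [R^c]-module of
    rank [n]. *)
Lemma fin_gen_dual (R : pzRingType) (X : lmodType R) :
  left_noetherian R^c -> fin_gen X -> fin_gen (dual X).
Proof.
move=> nR /fin_genP[n [p ps]]; have [u [ui us _]] := dual_rV R n.
have [v vP] : exists v : {linear dual X -> 'rV[R^c]_n}, forall f, u (v f) = dmap p f.
  by apply: corestrict => // f; exact: us.
apply: (noeth_rV nR (i := v)) => f g fg; apply: dualP => x; have [y <-] := ps x.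
have := congr1 u fg; rewrite !vP => /(congr1 (fun h : dual 'rV[R]_n => h y)).
exact.
Qed.

(** Left ideals of [R] and of [R^c] are the same sets. Commutativity of the graded ring enters here,
    to provide the finiteness of duals, which live over [R^c]. *)
Lemma left_noetherian_conv (R : pzRingType) : (forall x y : R, x * y = y * x) ->
  left_noetherian R -> left_noetherian R^c.
Proof.
move=> Rc nR I [sI mI]; have [|n [s ->]] := nR I.
  by split=> // a x Ix; rewrite Rc; exact: mI a x Ix.
exists n, s; apply/seteqP; split=> _ [c ->]; exists c; apply: eq_bigr => i _; exact: Rc.
Qed.

(** * Resolutions by modules of G-dimension zero *)

Section Splicing.
Variable R : pzRingType.
Implicit Types (A B C G K X Y Z P : lmodType R).

(** Transparent, so that the terms of the spliced resolution reduce in [gres_splice] and [gres0]. *)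
Definition splice_res K (Q : resolution K) X P (i : {linear K -> P})
  (p : {linear P -> X}) (s : ses i p) : resolution X.
Proof.
pose T (n : nat) : lmodType R := if n is k.+1 then Q k else P.
pose d (n : nat) : {linear T n.+1 -> T n} :=
  match n return {linear T n.+1 -> T n} with
  | 0 => i \o res_aug Q
  | k.+1 => res_d Q k
  end.
apply: (@Resolution R X T d p); first by case: s.
  have [_ ip _] := s => b; rewrite ip; split=> [[k <-]|[a <-]]; last by exists (res_aug Q a).
  by have [a <-] := res_aug_surj Q k; exists a.
case=> [|n] b; last exact: res_exactS.
have [ii _ _] := s.
by rewrite -res_exact0 /= -(linear0 i); split=> [/ii|->].
Defined.

(** Uniform in [n], whereas [Gdim_le] treats [n = 0] apart; the induction on the G-dimension runs on
    this form. *)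
Definition gres n X : Prop := exists G : resolution X,
  (forall i, (i <= n)%N -> fin_gen (G i) /\ gdim0 (G i)) /\
  (forall i, (n < i)%N -> forall x : G i, x = 0).

Lemma gres_splice n K X m (i : {linear K -> 'rV[R]_m}) (p : {linear 'rV[R]_m -> X}) :
  ses i p -> gres n K -> gres n.+1 X.
Proof.
move=> s [Q [Q1 Q2]]; exists (splice_res Q s); split=> -[|k] //= kn.
- by split; [exact: fin_gen_rV|exact: gdim0_rV].
- exact: Q1.
- exact: Q2.
Qed.

(** Resolutions are infinite by definition; this is the tail that completes a finite one. *)
Lemma trivial_res K : (forall x : K, x = 0) -> exists Q : resolution K,
  forall n (x : Q n), x = 0.
Proof.
move=> K0; pose T (n : nat) : lmodType R := K.
have e : exact_at (\0 : {linear K -> K}) (\0 : {linear K -> K}).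
  by move=> b; split=> // _; exists 0; rewrite (K0 b).
have s (x : K) : exists c : K, (\0 : {linear K -> K}) c = x by exists 0; rewrite (K0 x).
by exists (@Resolution R K T (fun n => \0) \0 s e (fun n => e)).
Qed.

Lemma gres0 X : fin_gen X -> gdim0 X -> gres 0 X.
Proof.
move=> fX gX; have [K [i [ii ip]]] := kernel_ex (@idfun X).
have K0 (x : K) : x = 0 by apply: ii; rewrite linear0; apply/ip; exists x.
have s : ses i (@idfun X) by split=> // x; exists x.
have [Q Q0] := trivial_res K0.
exists (splice_res Q s); split=> -[|k] //= _; exact: Q0.
Qed.

Lemma gres0_gdim0 X : gres 0 X -> gdim0 X.
Proof.
case=> G [/(_ 0%N isT)[_ gG] G0].
have ai : injective (res_aug G).
  move=> x y xy; apply/eqP; rewrite -subr_eq0; apply/eqP.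
  have [a <-] : exists a, res_d G 0 a = x - y.
    by apply/res_exact0; rewrite linearB xy subrr.
  by rewrite (G0 1%N isT a) linear0.
have [v vP] : exists v : {linear X -> G 0%N}, forall x, res_aug G (v x) = x.
  apply: (corestrict (f := @idfun X)) => // x; exact: res_aug_surj.
apply: (gdim0_iso (u := v)) gG; last by move=> y; exists (res_aug G y); apply: ai; rewrite vP.
by move=> x y xy; rewrite -(vP x) xy vP.
Qed.

(* [K'] below is the kernel of [(x, y) |-> l x + d y] on [P * G 1], where [l]
   lifts [p] to [G 0]; it maps onto [K] with the same kernel as [G 1 -> G 0]. *)
Lemma gres_syzygy n K X m (i : {linear K -> 'rV[R]_m}) (p : {linear 'rV[R]_m -> X}) :
  left_noetherian R -> ses i p -> gres n.+1 X -> gres n K.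
Proof.
move=> nR s [G [G1 G2]]; have [ii ip ps] := s.
have [l lP] := projective_rV p (@res_aug_surj _ _ G).
pose D : {linear ('rV[R]_m * G 1%N)%type -> G 0%N} := (l \o fst) \+ (res_d G 0 \o snd).
have aD w : res_aug G (D w) = p w.1.
  have d0 y : res_aug G (res_d G 0 y) = 0 by apply/res_exact0; exists y.
  by rewrite /= linearD lP d0 addr0.
have Ds : surj D.
  move=> g; have [x xP] := ps (res_aug G g).
  have [y yP] : exists y, res_d G 0 y = g - l x.
    by apply/res_exact0; rewrite linearB lP xP subrr.
  by exists (x, y); rewrite /= yP addrC subrK.
have [K' [j [ij jD]]] := kernel_ex D.
have [q qP] : exists q : {linear K' -> K}, forall w, i (q w) = (j w).1.
  apply: (corestrict (f := fst \o j)) => // w; apply/ip; rewrite /= -aD.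
  by have /jD -> : exists w', j w' = j w by [exists w]; rewrite linear0.
have [e eP] : exists e : {linear G 2%N -> K'}, forall z, j (e z) = (0, res_d G 1 z).
  have fl : linear (fun z => (0 : 'rV[R]_m, res_d G 1 z)).
    by move=> c x y; rewrite linearP; congr (_, _); rewrite /= scaler0 addr0.
  apply: (corestrict (f := mklin fl)) => // z; apply/jD.
  by rewrite /= linear0 add0r; apply/res_exactS; exists z.
pose T k : lmodType R := if k is k'.+1 then G k'.+2 else K'.
pose d (k : nat) : {linear T k.+1 -> T k} :=
  match k return {linear T k.+1 -> T k} with
  | 0 => e
  | k'.+1 => res_d G k'.+2
  end.
have qs : forall k, exists w, q w = k.
  move=> k; have [y yP] : exists y, res_d G 0 y = l (i k).
    by apply/res_exact0; rewrite lP (ses_ker s).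
  have [w wP] : exists w, j w = (i k, - y) by apply/jD; rewrite /= linearN yP subrr.
  by exists w; apply: ii; rewrite qP wP.
have e0 : exact_at (d 0%N) q.
  move=> w; split=> [qw|[z <-]].
    have w1 : (j w).1 = 0 by rewrite -qP qw linear0.
    have [z zP] : exists z, res_d G 1 z = (j w).2.
      apply/res_exactS; have : D (j w) = 0 by apply/jD; exists w.
      by rewrite /= w1 linear0 add0r.
    by exists z; apply: ij; rewrite eP zP -w1; case: (j w).
  by apply: ii; rewrite qP eP linear0.
have eS k : exact_at (d k.+1) (d k).
  case: k => [|k] b /=; last exact: res_exactS.
  rewrite -res_exactS; split=> [eb|db].
    by have := eP b; rewrite eb linear0 => -[].
  by apply: ij; rewrite eP db linear0.
(* The product is an extension of a free module by [G 1]; thus [K'] is the kernel of an epimorphism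
   between modules of G-dimension zero. *)
have gD : fin_gen ('rV[R]_m * G 1%N)%type /\ gdim0 ('rV[R]_m * G 1%N)%type.
  have inl : linear (fun y : G 1%N => (0 : 'rV[R]_m, y)).
    by move=> c x y; congr (_, _); rewrite /= scaler0 addr0.
  have sf : ses (mklin inl) (fst : {linear ('rV[R]_m * G 1%N)%type -> 'rV[R]_m}).
    split=> [x y []|[x y]|x] //; last by exists (x, 0).
    by split=> /= [->|[z [<-]]] //; exists y.
  have [f1 g1] := G1 1%N isT; split.
    exact: (fin_gen_mid sf f1 (fin_gen_rV R m)).
  exact: (gdim0_mid sf g1 (gdim0_rV R m)).
have sj : ses j D by [].
exists (@Resolution R K T d q qs e0 eS); split=> -[|k] //= kn; last exact: G2.
  split; first exact: noeth_fin_gen gD.1 _ _ ij.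
  have [_ g0] := G1 0%N isT; exact: (gdim0_left sj gD.2 g0).
exact: G1.
Qed.
End Splicing.

(** * Models of associated graded modules *)

Section Filtrations.
Variables (L : pzRingType) (F : ring_filtration L).

Lemma rfilZ_le p q : p <= q -> rfilZ F p `<=` rfilZ F q.
Proof.
case: p => [p|p]; last by move=> _ x /= ->; exact: (rfilZ_subgroup F q).1.
case: q => [q|q] //= pq; rewrite -(subnK (n := q) (m := p)) //.
by elim: (q - p)%N => // n IH x /IH; exact: rfilS.
Qed.

Lemma rfilZ_succ p : rfilZ F p `<=` rfilZ F (p + 1).
Proof. by apply: rfilZ_le; lia. Qed.

Lemma regfil_subproofM (p : nat) (q : int) a (x : L^o) :
  F p a -> rfilZ F q x -> rfilZ F (p%:Z + q) (a *: x).
Proof.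
case: q => [q|q] Fa /=; first exact: rfilM.
by move=> ->; rewrite scaler0; exact: (rfilZ_subgroup _ _).1.
Qed.

Lemma regfil_bounded : exists p0 : int, forall p, p0 <= p -> rfilZ F (- p) = [set (0 : L^o)].
Proof. by exists 1 => -[[|p]|p]. Qed.

Lemma regfil_cover (x : L^o) : exists p, rfilZ F p x.
Proof. by have [p Fx] := rfil_cover F x; exists p. Qed.

Definition regfil : module_filtration F L^o :=
  @ModuleFiltration L F L^o (rfilZ F) (rfilZ_subgroup F) rfilZ_succ regfil_bounded
    regfil_subproofM regfil_cover.

Section Module.
Variables (M : lmodType L) (FM : module_filtration F M).

Lemma mfil0 p : FM p 0.
Proof. exact: (mfil_subgroup FM p).1. Qed.

Lemma mfilB p x y : FM p x -> FM p y -> FM p (x - y).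
Proof. exact: (mfil_subgroup FM p).2. Qed.

Lemma mfilD p x y : FM p x -> FM p y -> FM p (x + y).
Proof. exact: (subgroupD (mfil_subgroup FM p)). Qed.

Lemma mfil_sum p (I : Type) (r : seq I) (P : pred I) (f : I -> M) :
  (forall i, P i -> FM p (f i)) -> FM p (\sum_(i <- r | P i) f i).
Proof. exact: (subgroup_sum (mfil_subgroup FM p)). Qed.

Lemma mfil_le p q : p <= q -> FM p `<=` FM q.
Proof.
move=> pq; have -> : q = p + (`|q - p|%N)%:Z by lia.
elim: `|_|%N => [|n IH] x; first by rewrite addr0.
by move=> /IH; rewrite -addn1 PoszD addrA; exact: mfilS.
Qed.

Lemma mfilMZ p q a x : rfilZ F p a -> FM q x -> FM (p + q) (a *: x).
Proof.
case: p => [p|p] /=; first exact: mfilM.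
by move=> -> _; rewrite scale0r; exact: mfil0.
Qed.

Lemma mfil_bound : exists b : int, forall p, p <= b -> forall x, FM p x -> x = 0.
Proof.
have [p0 h] := mfil_bounded FM; exists (- p0) => p pb x.
by rewrite -[p]opprK h; last lia.
Qed.

(** Filtrations vanish in low degrees. This is the induction behind every successive approximation
    of elements: match the symbol, subtract, and recurse on the remainder in degree [p - 1]. *)
Lemma mfil_ind (Q : int -> M -> Prop) :
  (forall p, Q p 0) ->
  (forall p x, FM p x -> (forall y, FM (p - 1) y -> Q (p - 1) y) -> Q p x) ->
  forall p x, FM p x -> Q p x.
Proof.
move=> Q0 QS; have [b hb] := mfil_bound.
have H n p x : p <= b + n%:Z -> FM p x -> Q p x.
  elim: n p x => [|n IH] p x pn px; first by rewrite (hb p _ x px) //; lia.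
  by apply: QS => // y; apply: IH; lia.
by move=> p x; apply: (H `|p - b|%N); lia.
Qed.
End Module.
End Filtrations.

(* [X] is (a model of) the associated graded module of [M]: [sg p x] is the
   class of [x] in degree [p], meaningful when [x] lies in [FM p], and [gpr p]
   is the projection of [X] onto its component of degree [p]. *)
Record grmodel (L : pzRingType) (F : ring_filtration L) (S : pzRingType)
    (sr : int -> L -> S) (M : lmodType L) (FM : module_filtration F M)
    (X : lmodType S) := GrModel {
  sg : int -> M -> X;
  gpr : int -> X -> X;
  sgD : forall p x y, FM p x -> FM p y -> sg p (x + y) = sg p x + sg p y;
  sg_eq0 : forall p x, FM p x -> (sg p x = 0 <-> FM (p - 1) x);
  sgZ : forall p q a x, rfilZ F p a -> FM q x -> sg (p + q) (a *: x) = sr p a *: sg q x;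
  gprD : forall p x y, gpr p (x + y) = gpr p x + gpr p y;
  gpr_lift : forall p x, exists m, FM p m /\ gpr p x = sg p m;
  gpr_sg : forall p q m, FM q m -> gpr p (sg q m) = if p == q then sg q m else 0;
  gpr_fin : forall x, exists s : seq int, uniq s /\ x = \sum_(p <- s) gpr p x }.

(** Symbols of scalars are a parameter of [grmodel], so the ring comes first: with respect to [rsg],
    [S] is a model of the regular module of [L], and multiplicativity of symbols becomes the field
    [sgZ]. *)
Record grring (L : pzRingType) (F : ring_filtration L) (S : pzRingType) := GrRing {
  rsg : int -> L -> S;
  grm : grmodel rsg (regfil F) S^o;
  rsgE : forall p a, sg grm p a = rsg p a;
  rsg1 : rsg 0 1 = 1 }.

Section GradedModels.
Variables (L : pzRingType) (F : ring_filtration L) (S : pzRingType).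
Variable gr : grring F S.

Definition rpr (p : int) (s : S) : S := gpr (grm gr) p s.

Lemma rprD p s t : rpr p (s + t) = rpr p s + rpr p t.
Proof. exact: (gprD (grm gr)). Qed.

Section Model.
Variables (M : lmodType L) (FM : module_filtration F M) (X : lmodType S).
Variable mX : grmodel (rsg gr) FM X.
Implicit Types (x y : X) (m : M).

Lemma sg0 p : sg mX p 0 = 0.
Proof. by apply/(sg_eq0 mX); exact: mfil0. Qed.

Lemma sgB p m m' : FM p m -> FM p m' -> sg mX p (m - m') = sg mX p m - sg mX p m'.
Proof.
move=> pm pm'; have pd := mfilB pm pm'.
by rewrite -{2}(subrK m' m) (sgD mX pd pm') addrK.
Qed.

Lemma sg_sum p (I : Type) (r : seq I) (f : I -> M) :
  (forall i, FM p (f i)) -> sg mX p (\sum_(i <- r) f i) = \sum_(i <- r) sg mX p (f i).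
Proof.
move=> pf; elim: r => [|i r IH]; first by rewrite !big_nil sg0.
by rewrite !big_cons sgD ?IH //; apply: mfil_sum.
Qed.

Lemma gpr0 p : gpr mX p 0 = 0.
Proof. by apply: (addrI (gpr mX p 0)); rewrite -gprD !addr0. Qed.

Lemma gpr_sum p (I : Type) (r : seq I) (f : I -> X) :
  gpr mX p (\sum_(i <- r) f i) = \sum_(i <- r) gpr mX p (f i).
Proof. by apply: (big_morph (gpr mX p)) => [x y|]; rewrite ?gprD ?gpr0. Qed.

Lemma gpr_gpr p q x : gpr mX p (gpr mX q x) = if p == q then gpr mX q x else 0.
Proof. by have [m [qm ->]] := gpr_lift mX q x; exact: gpr_sg. Qed.

Lemma gpr_supp x : exists s : seq int, forall p, p \notin s -> gpr mX p x = 0.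
Proof.
have [s [us xs]] := gpr_fin mX x; exists s => p ps.
rewrite xs gpr_sum big_seq big1 // => q qs; rewrite gpr_gpr.
by case: eqP => // pq; rewrite pq qs in ps.
Qed.

(** [gpr_fin] provides an unspecified list of degrees; freeing the sum from that choice lets several
    elements share one list. *)
Lemma gpr_sumE x (s : seq int) : uniq s ->
  (forall p, p \notin s -> gpr mX p x = 0) -> x = \sum_(p <- s) gpr mX p x.
Proof.
move=> us xs; have [t [ut xt]] := gpr_fin mX x.
rewrite {1}xt (bigID (mem s)) /= [X in _ + X]big1 ?addr0 => [|p /xs //].
rewrite -[LHS]big_filter [RHS](bigID (mem t)) /= [X in _ = _ + X]big1 ?addr0.
  rewrite -[RHS]big_filter; apply/perm_big/uniq_perm; rewrite ?filter_uniq //.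
  by move=> p; rewrite !mem_filter andbC.
move=> p pt; rewrite xt gpr_sum big_seq big1 // => q qt; rewrite gpr_gpr.
by case: eqP => // pq; rewrite pq qt in pt.
Qed.

Lemma homog_ind (Q : X -> Prop) : Q 0 -> (forall x y, Q x -> Q y -> Q (x + y)) ->
  (forall p m, FM p m -> Q (sg mX p m)) -> forall x, Q x.
Proof.
move=> Q0 QD Qs x; have [s [_ ->]] := gpr_fin mX x.
elim: s => [|p s IH]; rewrite ?big_nil // big_cons; apply: QD => //.
by have [m [pm ->]] := gpr_lift mX p x; exact: Qs.
Qed.
End Model.

Lemma rsg_ind (Q : S -> Prop) : Q 0 -> (forall x y, Q x -> Q y -> Q (x + y)) ->
  (forall p a, rfilZ F p a -> Q (rsg gr p a)) -> forall x, Q x.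
Proof.
move=> Q0 QD Qs; apply: (@homog_ind L^o (regfil F) S^o (grm gr) Q Q0 QD) => p a pa.
by rewrite rsgE; exact: Qs.
Qed.

Lemma rpr0 p : rpr p 0 = 0.
Proof. exact: (gpr0 (grm gr)). Qed.

Lemma rpr_lift p (s : S) : exists a, rfilZ F p a /\ rpr p s = rsg gr p a.
Proof. by have [a [pa sa]] := gpr_lift (grm gr) p s; exists a; rewrite -rsgE. Qed.

Lemma rpr_rsg p q a : rfilZ F q a -> rpr p (rsg gr q a) = if p == q then rsg gr q a else 0.
Proof. by move=> qa; rewrite -rsgE; exact: (gpr_sg (grm gr)). Qed.

Lemma rsgM p q a b : rfilZ F p a -> rfilZ F q b ->
  rsg gr (p + q) (a * b) = rsg gr p a * rsg gr q b.
Proof. by move=> pa qb; have := sgZ (grm gr) pa qb; rewrite !rsgE. Qed.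

Lemma rsgD p a b : rfilZ F p a -> rfilZ F p b ->
  rsg gr p (a + b) = rsg gr p a + rsg gr p b.
Proof. by move=> pa pb; have := sgD (grm gr) pa pb; rewrite !rsgE. Qed.

Lemma rsg_eq0 p a : rfilZ F p a -> (rsg gr p a = 0 <-> rfilZ F (p - 1) a).
Proof. by move=> pa; have := sg_eq0 (grm gr) pa; rewrite rsgE. Qed.

Section Model2.
Variables (M : lmodType L) (FM : module_filtration F M) (X : lmodType S).
Variable mX : grmodel (rsg gr) FM X.
Implicit Types (x y : X) (m : M).

Lemma gpr_scale p q a x : rfilZ F q a ->
  gpr mX (q + p) (rsg gr q a *: x) = rsg gr q a *: gpr mX p x.
Proof.
move=> qa; elim/(homog_ind (mX := mX)): x => [|x y hx hy|t m tm].
- by rewrite scaler0 !gpr0 scaler0.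
- by rewrite scalerDr !gprD hx hy scalerDr.
rewrite -(sgZ mX) // !gpr_sg //; last exact: mfilMZ.
rewrite (inj_eq (addrI q)); case: eqP => _; last by rewrite scaler0.
by rewrite (sgZ mX).
Qed.

Lemma gpr_scale_sg p q (s : S) m : FM q m ->
  gpr mX p (s *: sg mX q m) = rpr (p - q) s *: sg mX q m.
Proof.
move=> qm; elim/rsg_ind: s => [|s t hs ht|t a ta].
- by rewrite scale0r gpr0 rpr0 scale0r.
- by rewrite scalerDl gprD hs ht rprD scalerDl.
rewrite -(sgZ mX) // gpr_sg; last exact: mfilMZ.
by rewrite rpr_rsg // subr_eq; case: eqP => _; rewrite ?scale0r // (sgZ mX).
Qed.

(** The value [h p m] depends only on the class of [m] modulo degree [p - 1]. So [h p] may be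
    applied to any lift of the component of degree [p], and the results summed over [p]. *)
Lemma graded_hom_ext (Y : lmodType S) (h : int -> M -> Y) :
  (forall p m m', FM p m -> FM p m' -> h p (m + m') = h p m + h p m') ->
  (forall p m, FM (p - 1) m -> h p m = 0) ->
  (forall p q a m, rfilZ F p a -> FM q m -> h (p + q) (a *: m) = rsg gr p a *: h q m) ->
  exists H : {linear X -> Y}, forall p m, FM p m -> H (sg mX p m) = h p m.
Proof.
move=> hD h0 hZ.
have /choice[l lP] : forall px : int * X, exists m,
    FM px.1 m /\ gpr mX px.1 px.2 = sg mX px.1 m.
  by case=> p x; exact: gpr_lift.
pose c p x := h p (l (p, x)).
have cE p x m : FM p m -> gpr mX p x = sg mX p m -> c p x = h p m.
  have [pl xl] := lP (p, x); rewrite /= in pl xl => pm; rewrite xl => lm.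
  have pd := mfilB pl pm; rewrite /c -{1}(subrK m (l (p, x))) hD // h0 ?add0r //.
  by apply/(sg_eq0 mX pd); rewrite sgB // lm subrr.
have c0 p x : gpr mX p x = 0 -> c p x = 0.
  move=> px; rewrite (cE p x 0) ?h0 ?sg0 //; exact: mfil0.
have cD p x y : c p (x + y) = c p x + c p y.
  have [px xE] := lP (p, x); have [py yE] := lP (p, y).
  rewrite /= in px xE py yE.
  rewrite (cE p (x + y) (l (p, x) + l (p, y))) ?hD //; first exact: mfilD.
  by rewrite gprD xE yE sgD.
have /choice[s sP] := gpr_fin mX.
pose H x := \sum_(p <- s x) c p x.
(* The list [s x] was an arbitrary choice; additivity of [H] is checked on a list common to [x] and
   [y]. *)
have HE x t : uniq t -> (forall p, p \notin t -> gpr mX p x = 0) ->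
    H x = \sum_(p <- t) c p x.
  move=> ut xt; have [us xs] := sP x; rewrite /H.
  rewrite (bigID (mem t)) /= [X in _ + X]big1 ?addr0 => [|p /xt /c0 //].
  rewrite -[LHS]big_filter [RHS](bigID (mem (s x))) /= [X in _ = _ + X]big1 ?addr0.
    rewrite -[RHS]big_filter; apply/perm_big/uniq_perm; rewrite ?filter_uniq //.
    by move=> p; rewrite !mem_filter andbC.
  move=> p ps; apply: c0; rewrite xs gpr_sum big_seq big1 // => q qs.
  by rewrite gpr_gpr; case: eqP => // pq; rewrite pq qs in ps.
have HD x y : H (x + y) = H x + H y.
  have [sx xP] := gpr_supp mX x; have [sy yP] := gpr_supp mX y.
  have us := undup_uniq (sx ++ sy).
  have xs p : p \notin undup (sx ++ sy) -> gpr mX p x = 0.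
    by rewrite mem_undup mem_cat negb_or => /andP[/xP].
  have ys p : p \notin undup (sx ++ sy) -> gpr mX p y = 0.
    by rewrite mem_undup mem_cat negb_or => /andP[_ /yP].
  rewrite !(HE _ _ us) // -?big_split; first by apply: eq_bigr => p _; exact: cD.
  by move=> p ps; rewrite gprD xs // ys // addr0.
have Hs p m : FM p m -> H (sg mX p m) = h p m.
  move=> pm; rewrite (HE _ [:: p]) //.
    by rewrite big_seq1; apply: cE => //; rewrite gpr_sg // eqxx.
  by move=> q; rewrite inE gpr_sg // => /negPf ->.
have H0 : H 0 = 0 by apply: (addrI (H 0)); rewrite -HD !addr0.
have HZ a x : H (a *: x) = a *: H x.
  elim/rsg_ind: a x => [x|a b ha hb x|p a pa x]; first by rewrite !scale0r.
    by rewrite !scalerDl HD ha hb.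
  elim/(homog_ind (mX := mX)): x => [|x y hx hy|q m qm]; first by rewrite scaler0 H0 scaler0.
    by rewrite scalerDr !HD hx hy scalerDr.
  by rewrite -(sgZ mX) // !Hs ?hZ //; exact: mfilMZ.
have Hl : linear H by move=> a x y; rewrite HD HZ.
by exists (mklin Hl) => p m pm; exact: Hs.
Qed.

Lemma hom_sg_ext (Y : lmodType S) (f g : {linear X -> Y}) :
  (forall p m, FM p m -> f (sg mX p m) = g (sg mX p m)) -> f =1 g.
Proof.
move=> fg; apply: (homog_ind (mX := mX)) => [|x y hx hy|//]; first by rewrite !linear0.
by rewrite !linearD hx hy.
Qed.
End Model2.
End GradedModels.

(** * Filtered presentations *)

Section FreeFiltration.
Variables (L : pzRingType) (F : ring_filtration L) (r : nat) (d : 'I_r -> int).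

(** The shifted free module, with its [j]-th basis vector in degree [d j]. *)
Definition freefil_set (p : int) : set 'rV[L]_r :=
  [set x | forall j, rfilZ F (p - d j) (x 0 j)].

Lemma freefil_subgroup p : additive_subgroup (freefil_set p).
Proof.
split=> [j|x y px py j]; rewrite !mxE; first exact: (rfilZ_subgroup _ _).1.
exact: (rfilZ_subgroup _ _).2.
Qed.

Lemma freefil_succ p : freefil_set p `<=` freefil_set (p + 1).
Proof. by move=> x px j; apply: rfilZ_le (px j); lia. Qed.

Lemma freefil_bounded :
  exists p0 : int, forall p, p0 <= p -> freefil_set (- p) = [set 0].
Proof.
(* From this bound on every [- p - d j] is negative, and there [rfilZ] is zero. *)
exists (1 + \sum_j `|d j|%N%:Z) => p p0; apply/seteqP; split=> x; last first.
  by move=> -> j; rewrite mxE; exact: (rfilZ_subgroup _ _).1.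
move=> px; apply/rowP => j; rewrite mxE.
have dj : (`|d j|%N%:Z <= \sum_j `|d j|%N%:Z).
  by rewrite (bigD1 j) //= lerDl; apply: sumr_ge0.
have : - p - d j < 0 by lia.
by move: (px j); case: (- p - d j) => [n _|n pj _] //; exact: pj.
Qed.

Lemma freefilM (p : nat) (q : int) a (x : 'rV[L]_r) :
  F p a -> freefil_set q x -> freefil_set (p%:Z + q) (a *: x).
Proof. by move=> pa qx j; rewrite mxE -addrA; exact: (regfil_subproofM pa (qx j)). Qed.

Lemma freefil_cover (x : 'rV[L]_r) : exists p, freefil_set p x.
Proof.
have /choice[q qP] := fun j => rfil_cover F (x 0 j).
exists (\sum_j ((q j)%:Z + `|d j|%N%:Z)) => j.
apply: (@rfilZ_le _ _ (q j)%:Z) (qP j).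
have : (q j)%:Z + `|d j|%N%:Z <= \sum_j ((q j)%:Z + `|d j|%N%:Z).
  by rewrite (bigD1 j) //= lerDl; apply: sumr_ge0.
lia.
Qed.

Definition freefil : module_filtration F 'rV[L]_r :=
  ModuleFiltration freefil_subgroup freefil_succ freefil_bounded freefilM
    freefil_cover.

Lemma freefil_delta j : freefil (d j) (delta_mx 0 j).
Proof.
move=> k; rewrite mxE eqxx; case: eqP => [->|_]; last exact: (rfilZ_subgroup _ _).1.
by rewrite subrr; exact: rfil1.
Qed.
End FreeFiltration.

Section ComapFiltration.
Variables (L : pzRingType) (F : ring_filtration L) (M K : lmodType L).
Variables (FM : module_filtration F M) (i : {linear K -> M}) (ii : injective i).

Definition comapfil_set (p : int) : set K := [set k | FM p (i k)].

Lemma comapfil_subgroup p : additive_subgroup (comapfil_set p).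
Proof.
split=> [|x y px py]; rewrite /comapfil_set /= ?linear0 ?linearB; first exact: mfil0.
exact: mfilB.
Qed.

Lemma comapfil_succ p : comapfil_set p `<=` comapfil_set (p + 1).
Proof. by move=> x; exact: mfilS. Qed.

Lemma comapfil_bounded :
  exists p0 : int, forall p, p0 <= p -> comapfil_set (- p) = [set 0].
Proof.
have [p0 h] := mfil_bounded FM; exists p0 => p /h hp.
apply/seteqP; split=> x; rewrite /comapfil_set /= hp /=; last by move=> ->; rewrite linear0.
by move=> ix; apply: ii; rewrite ix linear0.
Qed.

Lemma comapfilM (p : nat) (q : int) a (x : K) :
  F p a -> comapfil_set q x -> comapfil_set (p%:Z + q) (a *: x).
Proof. by move=> pa qx; rewrite /comapfil_set /= linearZ; exact: mfilM. Qed.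

Lemma comapfil_cover (x : K) : exists p, comapfil_set p x.
Proof. exact: mfil_cover. Qed.

Definition comapfil : module_filtration F K :=
  ModuleFiltration comapfil_subgroup comapfil_succ comapfil_bounded comapfilM
    comapfil_cover.
End ComapFiltration.

Section Presentations.
Variables (L : pzRingType) (F : ring_filtration L) (S : pzRingType).
Variable gr : grring F S.
Local Notation sr := (rsg gr).
Local Notation rpr := (rpr gr).

Lemma free_model r (d : 'I_r -> int) :
  exists mX : grmodel sr (freefil F d) 'rV[S]_r,
    (forall p x j, sg mX p x 0 j = sr (p - d j) (x 0 j)) /\
    (forall p x j, gpr mX p x 0 j = rpr (p - d j) (x 0 j)).
Proof.
pose sgf (p : int) (x : 'rV[L]_r) : 'rV[S]_r := \row_j sr (p - d j) (x 0 j).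
pose prf (p : int) (x : 'rV[S]_r) : 'rV[S]_r := \row_j rpr (p - d j) (x 0 j).
have h1 p x y : freefil F d p x -> freefil F d p y -> sgf p (x + y) = sgf p x + sgf p y.
  by move=> px py; apply/rowP => j; rewrite !mxE rsgD.
have h2 p x : freefil F d p x -> (sgf p x = 0 <-> freefil F d (p - 1) x).
  move=> px; split=> [x0 j|px'].
    have /(congr1 (fun y : 'rV[S]_r => y 0 j)) := x0; rewrite !mxE.
    by move=> /rsg_eq0 - /(_ (px j)); rewrite addrAC.
  apply/rowP => j; rewrite !mxE; apply/rsg_eq0; first exact: px.
  by have := px' j; rewrite addrAC.
have h3 p q a x : rfilZ F p a -> freefil F d q x -> sgf (p + q) (a *: x) = sr p a *: sgf q x.
  by move=> pa qx; apply/rowP => j; rewrite !mxE -addrA rsgM.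
have h4 p x y : prf p (x + y) = prf p x + prf p y.
  by apply/rowP => j; rewrite !mxE rprD.
have h5 p x : exists m, freefil F d p m /\ prf p x = sgf p m.
  have /choice[m mP] := fun j => rpr_lift gr (p - d j) (x 0 j).
  exists (\row_j m j); split=> [j|]; first by rewrite mxE; have [] := mP j.
  by apply/rowP => j; rewrite !mxE; have [] := mP j.
have h6 p q m : freefil F d q m -> prf p (sgf q m) = if p == q then sgf q m else 0.
  move=> qm; apply/rowP => j; rewrite !mxE rpr_rsg; last exact: qm.
  by rewrite (inj_eq (addIr _)); case: eqP => _; rewrite !mxE.
have h7 x : exists s : seq int, uniq s /\ x = \sum_(p <- s) prf p x.
  have /choice[s sP] := fun j => gpr_supp (grm gr) (x 0 j).
  (* A component of degree [q] in the coordinate [j] contributes in degree [q + d j]. *)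
  pose t := undup (flatten [seq [seq q + d j | q <- s j] | j <- enum 'I_r]).
  exists t; split; first exact: undup_uniq.
  apply/rowP => j; rewrite summxE; under eq_bigr do rewrite mxE.
  rewrite -(big_map (fun p => p - d j) xpredT (fun p => rpr p (x 0 j))).
  apply: (gpr_sumE (mX := grm gr)).
    by rewrite map_inj_uniq ?undup_uniq //; exact: addIr.
  move=> p pt; apply: sP; apply: contraNN pt => ps.
  apply/mapP; exists (p + d j); last by rewrite addrK.
  rewrite mem_undup; apply/flattenP; exists [seq q + d j | q <- s j].
    by apply: map_f; rewrite mem_enum.
  by apply/mapP; exists p.
by exists (GrModel h1 h2 h3 h4 h5 h6 h7); split=> p x j; rewrite mxE.
Qed.

(** All structure is inherited through the injection [e]; the two conditions say that [Z] contains
    the symbols of [K] and that its homogeneous components are such symbols. *)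
Lemma sub_model (M K : lmodType L) (X Z : lmodType S) (FM : module_filtration F M)
    (mX : grmodel sr FM X) (i : {linear K -> M}) (ii : injective i)
    (e : {linear Z -> X}) :
  injective e ->
  (forall p k, FM p (i k) -> exists z, e z = sg mX p (i k)) ->
  (forall p z, exists k, FM p (i k) /\ gpr mX p (e z) = sg mX p (i k)) ->
  exists mZ : grmodel sr (comapfil FM ii) Z,
    forall p k, comapfil FM ii p k -> e (sg mZ p k) = sg mX p (i k).
Proof.
move=> ie sg_e pr_e.
have [sgf sgfP] : {f : int -> K -> Z | forall p k, FM p (i k) -> e (f p k) = sg mX p (i k)}.
  have /choice[f fP] : forall pk : int * K, exists z,
      FM pk.1 (i pk.2) -> e z = sg mX pk.1 (i pk.2).
    move=> [p k]; have [/sg_e[z zP]|nk] := pselect (FM p (i k)); first by exists z.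
    by exists 0.
  by exists (fun p k => f (p, k)) => p k; exact: (fP (p, k)).
have [prf prfP] : {f : int -> Z -> Z | forall p z, e (f p z) = gpr mX p (e z)}.
  have /choice[f fP] : forall pz : int * Z, exists z, e z = gpr mX pz.1 (e pz.2).
    by move=> [p z]; have [k [pk ->]] := pr_e p z; exact: sg_e.
  by exists (fun p k => f (p, k)) => p k; exact: (fP (p, k)).
have h1 p x y : comapfil FM ii p x -> comapfil FM ii p y -> sgf p (x + y) = sgf p x + sgf p y.
  move=> px py; have pxy := mfilD px py; apply: ie; rewrite linearD !sgfP //.
  by rewrite linearD; exact: sgD.
have h2 p x : comapfil FM ii p x -> (sgf p x = 0 <-> comapfil FM ii (p - 1) x).
  move=> px; rewrite -[X in _ <-> X]/(FM (p - 1) (i x)) -(sg_eq0 mX px) -sgfP //.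
  by split=> [->|]; rewrite -(linear0 e) // => /ie.
have h3 p q a x : rfilZ F p a -> comapfil FM ii q x -> sgf (p + q) (a *: x) = sr p a *: sgf q x.
  move=> pa qx; have pqx := mfilMZ pa qx.
  by apply: ie; rewrite linearZ !sgfP // linearZ; exact: sgZ.
have h4 p x y : prf p (x + y) = prf p x + prf p y.
  by apply: ie; rewrite linearD !prfP linearD gprD.
have h5 p z : exists m, comapfil FM ii p m /\ prf p z = sgf p m.
  have [k [pk zk]] := pr_e p z; exists k; split=> //.
  by apply: ie; rewrite prfP sgfP.
have h6 p q m : comapfil FM ii q m -> prf p (sgf q m) = if p == q then sgf q m else 0.
  move=> qm; apply: ie; rewrite prfP sgfP // gpr_sg //.
  by case: eqP => _; rewrite ?sgfP ?linear0.
have h7 x : exists s : seq int, uniq s /\ x = \sum_(p <- s) prf p x.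
  have [s [us xs]] := gpr_fin mX (e x); exists s; split=> //.
  by apply: ie; rewrite linear_sum {1}xs; apply: eq_bigr => p _; rewrite prfP.
by exists (GrModel h1 h2 h3 h4 h5 h6 h7) => p k; exact: sgfP.
Qed.

Section Generators.
Variables (M : lmodType L) (FM : module_filtration F M).

Definition gens r (d : 'I_r -> int) (m : 'I_r -> M) : Prop :=
  forall p x, FM p x <-> exists2 a, freefil F d p a & x = lincomb m a.

Definition good : Prop := exists r (d : 'I_r -> int) (m : 'I_r -> M), gens d m.

Lemma good_filtrationP : good_filtration FM <-> good.
Proof.
split=> -[r [d [m g]]]; exists r, d, m.
  move=> p x; rewrite g; split=> [[a [pa ->]]|[a pa ->]].
    exists (\row_k a k) => [k|]; first by rewrite mxE.
    by rewrite lincombE; apply: eq_bigr => k _; rewrite mxE.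
  by exists (a 0).
move=> p; apply/seteqP; split=> x; rewrite g; first by case=> a pa ->; exists (a 0).
case=> a [pa ->]; exists (\row_k a k) => [k|]; first by rewrite mxE.
by rewrite lincombE; apply: eq_bigr => k _; rewrite mxE.
Qed.

Lemma gens_mem r (d : 'I_r -> int) (m : 'I_r -> M) : gens d m -> forall j, FM (d j) (m j).
Proof.
by move=> g j; apply/g; exists (delta_mx 0 j); [exact: freefil_delta|rewrite lincomb_delta].
Qed.

Lemma gens_surj r (d : 'I_r -> int) (m : 'I_r -> M) : gens d m -> surj (lincomb m).
Proof. by move=> g x; have [p /g[a _ ->]] := mfil_cover FM x; exists a. Qed.

Variables (X : lmodType S) (mX : grmodel sr FM X).

Lemma gens_homogeneous : fin_gen X -> exists (T : finType) (d : T -> int) (m : T -> M),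
  (forall t, FM (d t) (m t)) /\
  forall x, exists c : T -> S, x = \sum_t c t *: sg mX (d t) (m t).
Proof.
move=> [n [x xP]].
have /choice[s sP] := fun k => gpr_fin mX (x k).
pose N := (\max_k size (s k))%N.
(* Past the end of [s t.1] the default 0 merely adds a component of degree 0 as a further
   generator. *)
pose d (t : 'I_n * 'I_N) := nth 0 (s t.1) t.2.
have /choice[m mP] : forall t, exists y, FM (d t) y /\ gpr mX (d t) (x t.1) = sg mX (d t) y.
  by move=> t; exact: gpr_lift.
exists ('I_n * 'I_N)%type, d, m; split=> [t|y]; first by have [] := mP t.
pose Q y := exists c : 'I_n * 'I_N -> S, y = \sum_t c t *: sg mX (d t) (m t).
have Q0 : Q 0 by exists (fun=> 0); rewrite big1 // => t _; rewrite scale0r.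
have QD u v : Q u -> Q v -> Q (u + v).
  move=> [c ->] [c' ->]; exists (fun t => c t + c' t); rewrite -big_split.
  by apply: eq_bigr => t _; rewrite scalerDl.
have QZ a u : Q u -> Q (a *: u).
  move=> [c ->]; exists (fun t => a * c t); rewrite scaler_sumr.
  by apply: eq_bigr => t _; rewrite scalerA.
have Qsum (I : eqType) (l : seq I) (f : I -> X) :
    (forall i, i \in l -> Q (f i)) -> Q (\sum_(i <- l) f i).
  move=> Qf; rewrite big_seq; elim/big_ind: _ => //; exact: QD.
rewrite -/(Q y); have [c ->] := xP y; apply: (Qsum) => k _; apply: QZ.
have [_ ->] := sP k; apply: Qsum => p ps.
have pN : (index p (s k) < N)%N.
  by apply: leq_trans (leq_bigmax k); rewrite index_mem.
pose t : 'I_n * 'I_N := (k, Ordinal pN).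
have dt : d t = p by rewrite /d /= nth_index.
exists (fun t' => if t' == t then 1 else 0).
rewrite (bigD1 t) //= big1 ?addr0 ?eqxx ?scale1r => [|t' /negPf ->]; last by rewrite scale0r.
by have [_] := mP t; rewrite dt.
Qed.

(** Lifts of homogeneous generators of [X] generate the filtration, since a lifted combination with
    the symbol of [x] differs from [x] by something of degree [p - 1]. For Noetherian [S] this makes
    the filtration induced on a syzygy good. *)
Lemma good_fin_gen : fin_gen X -> good.
Proof.
move=> /gens_homogeneous[T [d [m [dm hm]]]].
have H p x : FM p x -> exists a : T -> L,
    (forall t, rfilZ F (p - d t) (a t)) /\ x = \sum_t a t *: m t.
  elim/mfil_ind: p x / => [p|p x px IH].
    exists (fun=> 0); rewrite big1 => [|t _]; last by rewrite scale0r.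
    by split=> // t; exact: (rfilZ_subgroup _ _).1.
  have [c cP] := hm (sg mX p x).
  (* Only the component of degree [p - d t] of the coefficient [c t] contributes in degree [p]. *)
  have /choice[a aP] := fun t => rpr_lift gr (p - d t) (c t).
  have am t : FM p (a t *: m t).
    by have [pa _] := aP t; have := mfilMZ pa (dm t); rewrite subrK.
  have sx : sg mX p x = sg mX p (\sum_t a t *: m t).
    rewrite sg_sum //.
    have /(congr1 (gpr mX p)) := cP; rewrite gpr_sg // eqxx gpr_sum => ->.
    apply: eq_bigr => t _; rewrite gpr_scale_sg //; have [pa ->] := aP t.
    by rewrite -(sgZ mX) // subrK.
  have px' : FM p (\sum_t a t *: m t) by exact: mfil_sum.
  have [|b [bP xb]] := IH (x - \sum_t a t *: m t).
    by apply/(sg_eq0 mX (mfilB px px')); rewrite sgB // sx subrr.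
  exists (fun t => a t + b t); split=> [t|].
    apply: (subgroupD (rfilZ_subgroup _ _)); first by have [] := aP t.
    by apply: rfilZ_le (bP t); lia.
  under eq_bigr do rewrite scalerDl.
  by rewrite big_split /= -xb addrC subrK.
exists #|T|, (d \o enum_val), (m \o enum_val) => p x; split=> [/H[a [pa ->]]|[a pa ->]].
  exists (\row_k a (enum_val k)) => [k|]; first by rewrite mxE; exact: pa.
  rewrite lincombE (reindex (fun k : 'I_#|T| => enum_val k)) /=; last exact/onW_bij/enum_val_bij.
  by apply: eq_bigr => k _; rewrite mxE.
apply: mfil_sum => k _; have := mfilMZ (pa k) (dm (enum_val k)).
by rewrite /= subrK.
Qed.

Section Presentation.
Variables (r : nat) (d : 'I_r -> int) (m : 'I_r -> M) (g : gens d m).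
Variable fm : grmodel sr (freefil F d) 'rV[S]_r.
Hypothesis fmE : forall p x j, sg fm p x 0 j = sr (p - d j) (x 0 j).

Definition sg_lincomb : {linear 'rV[S]_r -> X} := lincomb (fun j => sg mX (d j) (m j)).

Lemma sg_lincomb_sg p x : freefil F d p x -> sg_lincomb (sg fm p x) = sg mX p (lincomb m x).
Proof.
move=> px; rewrite !lincombE sg_sum => [|j]; last first.
  by have := mfilMZ (px j) (gens_mem g j); rewrite subrK.
apply: eq_bigr => j _; rewrite fmE -(sgZ mX) ?subrK //; exact: gens_mem.
Qed.

Lemma sg_lincomb_surj : surj sg_lincomb.
Proof.
apply: (homog_ind (mX := mX)) => [|x y [u <-] [v <-]|p x /g[a pa ->]].
- by exists 0; rewrite linear0.
- by exists (u + v); rewrite linearD.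
- by exists (sg fm p a); rewrite sg_lincomb_sg.
Qed.

Lemma good_fin_gen_model : fin_gen X.
Proof. exact: fin_gen_surj sg_lincomb_surj (fin_gen_rV _ _). Qed.

Lemma sg_lincomb_gpr p x : sg_lincomb (gpr fm p x) = gpr mX p (sg_lincomb x).
Proof.
elim/(homog_ind (mX := fm)): x => [|x y hx hy|q a qa].
- by rewrite gpr0 !linear0 gpr0.
- by rewrite gprD !linearD hx hy gprD.
rewrite gpr_sg // sg_lincomb_sg // gpr_sg; last by apply/g; exists a.
by case: eqP => _; rewrite ?linear0 ?sg_lincomb_sg.
Qed.

(** Kernels commute with passing to graded modules because the presentation is strict: if the symbol
    of [a] is killed, [lincomb m a] has degree [p - 1], so it equals [lincomb m b] with [b] of
    degree [p - 1], and [a - b] is a relation with the symbol of [a]. *)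
Lemma syzygy_model : exists (K : lmodType L) (i : {linear K -> 'rV[L]_r})
    (ii : injective i) (Z : lmodType S) (e : {linear Z -> 'rV[S]_r})
    (mZ : grmodel sr (comapfil (freefil F d) ii) Z),
  [/\ ses i (lincomb m), ses e sg_lincomb &
      forall p k, comapfil (freefil F d) ii p k -> e (sg mZ p k) = sg fm p (i k)].
Proof.
have [K [i [ii ip]]] := kernel_ex (lincomb m).
have [Z [e [ie ep]]] := kernel_ex sg_lincomb.
have mk k : lincomb m (i k) = 0 by apply/ip; exists k.
exists K, i, ii, Z, e.
have [||mZ mZP] := sub_model (mX := fm) ii ie.
- by move=> p k pk; apply/ep; rewrite sg_lincomb_sg // mk sg0.
- move=> p z; have [a [pa za]] := gpr_lift fm p (e z).
  have : sg mX p (lincomb m a) = 0.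
    rewrite -sg_lincomb_sg // -za sg_lincomb_gpr (_ : sg_lincomb _ = 0) ?gpr0 //.
    by apply/ep; exists z.
  move=> /(sg_eq0 mX ((g _ _).2 (ex_intro2 _ _ _ pa erefl))) /g[b pb ab].
  have pb' : freefil F d p b by apply: mfil_le pb; lia.
  have [k kP] : exists k, i k = a - b by apply/ip; rewrite linearB ab subrr.
  exists k; rewrite kP; split; first exact: mfilB.
  by rewrite sgB // (_ : sg fm p b = 0) ?subr0 //; apply/(sg_eq0 fm).
exists mZ; split=> //; split=> //; [exact: gens_surj g|exact: sg_lincomb_surj].
Qed.
End Presentation.
End Generators.
End Presentations.

(** * Lifting linear forms *)

Section Degrees.
Variables (L : pzRingType) (F : ring_filtration L) (M : lmodType L).
Variable FM : module_filtration F M.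
Implicit Types (h : {linear M -> L^o}).

Definition degree_le c h : Prop := forall p x, FM p x -> rfilZ F (p + c) (h x).

Section Gens.
Variables (r : nat) (d : 'I_r -> int) (m : 'I_r -> M) (g : gens FM d m).

Lemma degree_gens c h :
  (forall j, rfilZ F (d j + c) (h (m j))) -> degree_le c h.
Proof.
move=> hm p x /g[a pa ->]; rewrite lincombE linear_sum.
apply: (mfil_sum (FM := regfil F)) => j _; rewrite linearZ /=.
have := mfilMZ (FM := regfil F) (pa j) (hm j).
by rewrite addrA subrK.
Qed.

Lemma sumr_abs_ge j : `|d j|%N%:Z <= \sum_j `|d j|%N%:Z.
Proof. by rewrite (bigD1 j) //= lerDl; apply: sumr_ge0. Qed.

(** [L] has nothing in negative degrees, and the constant forces [d j + c < 0] at every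
    generator. *)
Lemma degree_bounded : exists b : int, forall (c : int) h, c <= b -> degree_le c h ->
  forall x, h x = 0.
Proof.
exists (- 1 - \sum_j `|d j|%N%:Z) => c h cb hc x.
have [a <-] := gens_surj g x; rewrite lincombE linear_sum big1 // => j _.
rewrite linearZ /= (_ : h _ = 0) ?scaler0 //.
have := hc _ _ (gens_mem g j); have := sumr_abs_ge j.
have : d j + c < 0 by have := sumr_abs_ge j; lia.
by case: (d j + c) => [n|n _ _] //; exact.
Qed.

Lemma degree_cover h : exists c, degree_le c h.
Proof.
have /choice[q qP] := fun j => rfil_cover F (h (m j)).
exists (\sum_j ((q j)%:Z + `|d j|%N%:Z)); apply: degree_gens => j.
apply: (@rfilZ_le _ _ (q j)%:Z) (qP j).
have : (q j)%:Z + `|d j|%N%:Z <= \sum_j ((q j)%:Z + `|d j|%N%:Z).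
  by rewrite (bigD1 j) //= lerDl; apply: sumr_ge0.
lia.
Qed.
End Gens.
End Degrees.

Section FilteredExt.
Variables (L : pzRingType) (F : ring_filtration L) (S : pzRingType).
Variable gr : grring F S.
Local Notation sr := (rsg gr).
Local Notation rpr := (rpr gr).

Lemma rpr_scale p q a s : rfilZ F q a -> rpr (q + p) (sr q a * s) = sr q a * rpr p s.
Proof. exact: (gpr_scale (grm gr)). Qed.

Lemma rpr_sum p (I : Type) (r : seq I) (f : I -> S) :
  rpr p (\sum_(i <- r) f i) = \sum_(i <- r) rpr p (f i).
Proof. exact: (gpr_sum (grm gr)). Qed.

Lemma rsg_sum p (I : Type) (r : seq I) (f : I -> L) :
  (forall i, rfilZ F p (f i)) -> sr p (\sum_(i <- r) f i) = \sum_(i <- r) sr p (f i).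
Proof.
move=> pf; rewrite -rsgE (sg_sum (grm gr)) //.
by apply: eq_bigr => i _; rewrite rsgE.
Qed.

Section Symbol.
Variables (M : lmodType L) (FM : module_filtration F M) (X : lmodType S).
Variable mX : grmodel sr FM X.

Lemma symbol_ex c (h : {linear M -> L^o}) : degree_le FM c h ->
  exists H : {linear X -> S^o}, forall p x, FM p x -> H (sg mX p x) = sr (p + c) (h x).
Proof.
move=> hc; apply: graded_hom_ext => [p x y px py|p x px|p q a x pa qx].
- by rewrite linearD rsgD //; exact: hc.
- have /= := hc _ _ px; rewrite addrAC => h'.
  have hx : rfilZ F (p + c) (h x) by apply: rfilZ_le h'; lia.
  by apply/(rsg_eq0 gr hx).
- by rewrite linearZ -addrA rsgM //; exact: hc.
Qed.
End Symbol.

Section Extension.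
Variables (r : nat) (d : 'I_r -> int).
Variable fm : grmodel sr (freefil F d) 'rV[S]_r.
Hypothesis fmE : forall p x j, sg fm p x 0 j = sr (p - d j) (x 0 j).
Variables (K : lmodType L) (i : {linear K -> 'rV[L]_r}) (ii : injective i).
Variables (Z : lmodType S) (e : {linear Z -> 'rV[S]_r}).
Variable mZ : grmodel sr (comapfil (freefil F d) ii) Z.
Hypothesis mZP : forall p k, comapfil (freefil F d) ii p k -> e (sg mZ p k) = sg fm p (i k).

(* Correct an extension of the symbol of [h] degree by degree; the process
   stops because [h] vanishes once its degree is low enough. *)
Lemma filtered_extends : extends S^o e -> good (comapfil (freefil F d) ii) ->
  forall c (h : {linear K -> L^o}), degree_le (comapfil (freefil F d) ii) c h ->
  exists2 w : 'I_r -> L^o, forall j, rfilZ F (d j + c) (w j) &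
    forall k, lincomb w (i k) = h k.
Proof.
move=> ext [rK [dK [mK gK]]] c h hc; have [b hb] := degree_bounded gK.
have H n : forall (c : int) h, c <= b + n%:Z -> degree_le (comapfil (freefil F d) ii) c h ->
    exists2 w : 'I_r -> L^o, forall j, rfilZ F (d j + c) (w j) &
      forall k, lincomb w (i k) = h k.
  elim: n => [|n IH] {hc}c {}h cb hc.
    exists (fun=> 0) => [j|k]; first exact: (rfilZ_subgroup _ _).1.
    rewrite (hb c) // ?lincombE ?big1 // => [j _|]; last lia.
    by rewrite scaler0.
  have [H HP] := symbol_ex mZ hc; have [G GP] := ext H.
  (* [G] need not be homogeneous; only the part of degree [d j + c] of its value at the [j]-th basis
     vector is kept and lifted to [L]. *)
  have /choice[w wP] : forall j, exists a : L^o, rfilZ F (d j + c) a /\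
      rpr (d j + c) (G (delta_mx 0 j)) = sr (d j + c) a.
    by move=> j; have [a aP] := rpr_lift gr (d j + c) (G (delta_mx 0 j)); exists a.
  (* On [K] both forms have the same symbol, so their difference drops in degree. *)
  have hw : degree_le (comapfil (freefil F d) ii) (c - 1) (h \- (lincomb w \o i)).
    move=> p k pk; have hk := hc _ _ pk; rewrite addrA.
    have wk j : rfilZ F (p + c) (i k 0 j * w j).
      have [dw _] := wP j; have := mfilMZ (FM := regfil F) (pk j) dw.
      by rewrite addrA subrK.
    have wk' : rfilZ F (p + c) (lincomb w (i k)).
      by apply: (mfil_sum (FM := regfil F)) => j _; exact: wk.
    have hwk : rfilZ F (p + c) (h k - lincomb w (i k)).
      exact: (rfilZ_subgroup _ _).2.
    apply/(rsg_eq0 gr hwk); apply/eqP.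
    rewrite -rsgE (sgB (grm gr) hk wk') !rsgE subr_eq0; apply/eqP.
    rewrite rsg_sum; last exact: wk.
    have kk := HP _ _ pk; rewrite -GP mZP // in kk.
    have := congr1 (rpr (p + c)) kk; rewrite rpr_rsg // eqxx => <-.
    rewrite linear_rV rpr_sum; apply: eq_bigr => j _.
    have [dw wj] := wP j; have -> : p + c = p - d j + (d j + c) by lia.
    rewrite rsgM //.
    by rewrite fmE -wj -(rpr_scale _ _ (pk j)).
  have [|w' w'd w'P] := IH _ _ _ hw; first lia.
  exists (fun j => w j + w' j) => [j|k].
    apply: (subgroupD (rfilZ_subgroup _ _)); first by have [] := wP j.
    by apply: rfilZ_le (w'd j); lia.
  have -> : lincomb (fun j => w j + w' j : L^o) (i k) = lincomb w (i k) + lincomb w' (i k).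
    by rewrite !lincombE -big_split; apply: eq_bigr => j _; rewrite scalerDr.
  by rewrite w'P /= addrC subrK.
apply: (H `|c - b|%N c h) => //; lia.
Qed.
End Extension.

Lemma vext_filtered k : left_noetherian S ->
  forall (M : lmodType L) (FM : module_filtration F M) (X : lmodType S),
  grmodel sr FM X -> good FM -> vext S^o k X -> vext L^o k M.
Proof.
move=> nS; elim: k => [|k IH] M FM X mX [r [d [m g]]] vX;
  have [fm [fmE _]] := free_model gr d;
  have [K [i [ii [Z [e [mZ [sK sZ mZP]]]]]]] := syzygy_model mX g fmE;
  have gK : good (comapfil (freefil F d) ii)
    by apply: (good_fin_gen mZ); case: sZ => ie _ _;
       exact: noeth_fin_gen nS _ (fin_gen_rV _ _) _ _ ie.
  apply: (vext_one sK (@projective_rV _ _)) => h.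
  have [rK [dK [mK gK']]] := gK; have [c hc] := degree_cover gK' h.
  have [w _ wP] := filtered_extends fmE mZP (vX _ _ _ _ sZ) gK hc.
  by exists (lincomb w).
apply: (vext_shift sK (@projective_rV _ _)).
apply: (IH _ _ _ mZ gK); exact: vX sZ (@projective_rV _ _).
Qed.

(** Surjectivity of [gr Hom(M, L) -> Hom(gr M, S)]. On generators [f] lifts to some [w]. As [f]
    kills the symbols of relations, [w] has degree [c - 1] on [K]; it extends from there, with that
    degree, to [w'], and [w - w'] descends to [M] with symbol [f]. The degree bound in
    [filtered_extends] serves this purpose. *)
Lemma lift_symbol (M : lmodType L) (FM : module_filtration F M) (X : lmodType S)
    (mX : grmodel sr FM X) c (f : {linear X -> S^o}) :
  left_noetherian S -> good FM -> vext S^o 0 X ->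
  (forall p x, FM p x -> rpr (p + c) (f (sg mX p x)) = f (sg mX p x)) ->
  exists h : {linear M -> L^o}, degree_le FM c h /\
    forall p x, FM p x -> f (sg mX p x) = sr (p + c) (h x).
Proof.
move=> nS [r [d [m g]]] vX fc.
have [fm [fmE _]] := free_model gr d.
have [K [i [ii [Z [e [mZ [sK sZ mZP]]]]]]] := syzygy_model mX g fmE.
have gK : good (comapfil (freefil F d) ii).
  apply: (good_fin_gen mZ); case: sZ => ie _ _.
  exact: noeth_fin_gen nS _ (fin_gen_rV _ _) _ _ ie.
have /choice[w wP] : forall j, exists a : L^o,
    rfilZ F (d j + c) a /\ f (sg mX (d j) (m j)) = sr (d j + c) a.
  move=> j; rewrite -fc; last exact: (gens_mem g).
  by have [a aP] := rpr_lift gr (d j + c) (f (sg mX (d j) (m j))); exists a.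
have wE p a : freefil F d p a ->
    rfilZ F (p + c) (lincomb w a) /\ f (sg mX p (lincomb m a)) = sr (p + c) (lincomb w a).
  move=> pa; have wa j : rfilZ F (p + c) (a 0 j *: w j).
    have [dw _] := wP j; have := mfilMZ (FM := regfil F) (pa j) dw.
    by rewrite addrA subrK.
  split; first by apply: (mfil_sum (FM := regfil F)) => j _; exact: wa.
  rewrite -(sg_lincomb_sg mX g fmE) // !lincombE linear_sum rsg_sum //.
  apply: eq_bigr => j _; have [dw wj] := wP j; rewrite linearZ /= wj fmE.
  rewrite -[LHS]/(sr (p - d j) (a 0 j) * sr (d j + c) (w j)) -rsgM //.
  by congr (sr _ _); lia.
have hc : degree_le (comapfil (freefil F d) ii) (c - 1) (lincomb w \o i).
  move=> p k pk; have [pw fk] := wE _ _ pk; rewrite addrA.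
  by apply/(rsg_eq0 gr pw); rewrite -fk (ses_ker sK) sg0 linear0.
have [w' w'd w'P] := filtered_extends fmE mZP (vX _ _ _ _ sZ) gK hc.
have [h hP] : exists h : {linear M -> L^o}, forall a, h (lincomb m a) = lincomb w a - lincomb w' a.
  apply: (factor_surj (f := lincomb w \- lincomb w')); first exact: gens_surj g.
  have [_ iK _] := sK => a /iK[k <-].
  by rewrite -[LHS]/(lincomb w (i k) - lincomb w' (i k)) w'P subrr.
have w'a p a : freefil F d p a -> rfilZ F (p + c - 1) (lincomb w' a).
  move=> pa; apply: (mfil_sum (FM := regfil F)) => j _.
  have := mfilMZ (FM := regfil F) (pa j) (w'd j).
  by have -> : p - d j + (d j + (c - 1)) = p + c - 1 by lia.
have hc' : degree_le FM c h.
  move=> p x /g[a pa ->]; rewrite hP; apply: (rfilZ_subgroup _ _).2.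
    by have [] := wE _ _ pa.
  by apply: rfilZ_le (w'a _ _ pa); lia.
exists h; split=> // p x /g[a pa ->]; rewrite hP; have [pw ->] := wE _ _ pa.
have pw' := w'a _ _ pa; have pw'' : rfilZ F (p + c) (lincomb w' a) by apply: rfilZ_le pw'; lia.
rewrite -!rsgE (sgB (grm gr) pw pw'') [X in _ - X](_ : _ = 0) ?subr0 //.
by apply/(sg_eq0 (grm gr)).
Qed.
End FilteredExt.

(** * Duals of filtered modules *)

Section Converse.
Variables (L : pzRingType) (F : ring_filtration L).

Lemma convfilM (p q : nat) (x y : L^c) : F p x -> F q y -> F (p + q)%N (x * y).
Proof. by move=> px qy; rewrite addnC; exact: (rfilM (r := F)). Qed.

Definition convfil : ring_filtration L^c :=
  @RingFiltration L^c F (rfil_subgroup F) (rfil1 F) (@rfilS _ F) convfilM (rfil_cover F).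

Lemma rfilZ_conv p : rfilZ convfil p = rfilZ F p.
Proof. by case: p. Qed.

Variables (S : pzRingType) (gr : grring F S).

(** The maps of [gr] work unchanged over the opposite rings; the equation lets symbols over both be
    compared. *)
Lemma convring_ex : exists gc : grring convfil S^c, rsg gc = rsg gr.
Proof.
have h1 p x y : regfil convfil p x -> regfil convfil p y ->
    (rsg gr p (x + y) : S^c^o) = rsg gr p x + rsg gr p y.
  by rewrite /= !rfilZ_conv => px py; exact: (rsgD gr px py).
have h2 p x : regfil convfil p x ->
    ((rsg gr p x : S^c^o) = 0 <-> regfil convfil (p - 1) x).
  by rewrite /= !rfilZ_conv => px; exact: (rsg_eq0 gr px).
have h3 p q a x : rfilZ convfil p a -> regfil convfil q x ->
    (rsg gr (p + q) (a *: x) : S^c^o) = (rsg gr p a : S^c) *: (rsg gr q x : S^c^o).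
  rewrite /= !rfilZ_conv => pa qx; rewrite addrC; exact: (rsgM gr qx pa).
have h4 p (x y : S^c^o) : (rpr gr p (x + y) : S^c^o) = rpr gr p x + rpr gr p y.
  exact: (rprD gr p x y).
have h5 p (x : S^c^o) : exists m, regfil convfil p m /\ (rpr gr p x : S^c^o) = rsg gr p m.
  by have [a [pa ->]] := rpr_lift gr p x; exists a; rewrite /= rfilZ_conv.
have h6 p q m : regfil convfil q m ->
    (rpr gr p (rsg gr q m) : S^c^o) = if p == q then rsg gr q m else 0.
  by rewrite /= !rfilZ_conv => qm; exact: (rpr_rsg gr p qm).
have h7 (x : S^c^o) : exists s : seq int, uniq s /\ x = \sum_(p <- s) (rpr gr p x : S^c^o).
  exact: (gpr_fin (grm gr) x).
by exists (@GrRing L^c convfil S^c (rsg gr) (GrModel h1 h2 h3 h4 h5 h6 h7)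
  (fun p a => erefl) (rsg1 gr)).
Qed.
End Converse.

Section DualFiltration.
Variables (L : pzRingType) (F : ring_filtration L) (M : lmodType L).
Variables (FM : module_filtration F M) (gM : good FM).

Definition dualfil_set (c : int) : set (dual M) :=
  [set f | degree_le FM c (f : {linear M -> L^o})].

Lemma dualfil_subgroup c : additive_subgroup (dualfil_set c).
Proof.
split=> [p x _|f g fc gc p x px]; first exact: (rfilZ_subgroup _ _).1.
by apply: (rfilZ_subgroup _ _).2; [exact: fc|exact: gc].
Qed.

Lemma dualfil_succ c : dualfil_set c `<=` dualfil_set (c + 1).
Proof. by move=> f fc p x px; apply: rfilZ_le (fc p x px); lia. Qed.

Lemma dualfil_bounded :
  exists p0 : int, forall p, p0 <= p -> dualfil_set (- p) = [set 0].
Proof.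
have [r [d [m g]]] := gM; have [b hb] := degree_bounded g.
exists (- b) => p pb; apply/seteqP; split=> f; last first.
  by move=> -> q x _; exact: (rfilZ_subgroup _ _).1.
by move=> fp; apply: dualP => x; apply: hb fp x; lia.
Qed.

Lemma dualfilM (p : nat) (q : int) (a : L^c) (f : dual M) :
  convfil F p a -> dualfil_set q f -> dualfil_set (p%:Z + q) (a *: f).
Proof.
move=> pa fq s x sx; have := mfilMZ (FM := regfil F) (fq _ _ sx) (pa : rfilZ F p a).
by have -> : s + q + p%:Z = s + (p%:Z + q) by lia.
Qed.

Lemma dualfil_cover (f : dual M) : exists p, dualfil_set p f.
Proof. by have [r [d [m g]]] := gM; exact: degree_cover g f. Qed.

Definition dualfil : module_filtration (convfil F) (dual M) :=
  ModuleFiltration dualfil_subgroup dualfil_succ dualfil_bounded dualfilM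
    dualfil_cover.
End DualFiltration.

Lemma dual_sum (R : pzRingType) (X : lmodType R) (I : Type) (s : seq I)
    (f : I -> dual X) x : (\sum_(i <- s) f i : dual X) x = \sum_(i <- s) f i x.
Proof. exact: (big_morph (fun f : dual X => f x)). Qed.

Lemma rpr_idem (L : pzRingType) (F : ring_filtration L) (S : pzRingType)
  (gr : grring F S) p s : rpr gr p (rpr gr p s) = rpr gr p s.
Proof. by have := gpr_gpr (grm gr) p p s; rewrite eqxx. Qed.

Lemma bidual_mapD (R : pzRingType) (X : lmodType R) (x y : X) :
  bidual_map (x + y) = bidual_map x + bidual_map y.
Proof. by apply: dualP => f; exact: (dual_valD f). Qed.

Lemma bidual_map0 (R : pzRingType) (X : lmodType R) : bidual_map (0 : X) = 0.
Proof. by apply: dualP => f; exact: (dual_val0 f). Qed.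

Section DualModel.
Variables (L : pzRingType) (F : ring_filtration L) (S : pzRingType).
Variables (gr : grring F S) (gc : grring (convfil F) S^c) (gcE : rsg gc = rsg gr).
Local Notation sr := (rsg gr).
Variables (M : lmodType L) (FM : module_filtration F M) (X : lmodType S).
Variable mX : grmodel sr FM X.
Hypotheses (nS : left_noetherian S) (gM : good FM) (vX : vext S^o 0 X).

(** The component of degree [c] of a form on [X] is the part of it that raises degrees by [c]. That
    it is the symbol of a form on [M] is [lift_symbol], where the vanishing of Ext^1 is used. *)
Lemma dual_model : exists mD : grmodel (rsg gc) (dualfil gM) (dual X),
  forall c f, degree_le FM c (f : {linear M -> L^o}) -> forall p x, FM p x ->
    (sg mD c f) (sg mX p x) = sr (p + c) (f x).
Proof.
have [sgf sgfP] : {sgf : int -> dual M -> dual X | forall c (f : dual M),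
    degree_le FM c (f : {linear M -> L^o}) -> forall p x, FM p x ->
    sgf c f (sg mX p x) = sr (p + c) (f x)}.
  have /choice[u uP] : forall cf : int * dual M, exists u : dual X,
      degree_le FM cf.1 (cf.2 : {linear M -> L^o}) -> forall p x, FM p x ->
      u (sg mX p x) = sr (p + cf.1) (cf.2 x).
    move=> [c f]; have [fc|nf] := pselect (degree_le FM c (f : {linear M -> L^o})).
      by have [H HP] := symbol_ex mX fc; exists H.
    by exists 0.
  by exists (fun c f => u (c, f)) => c f; exact: (uP (c, f)).
have [prf prfP] : {prf : int -> dual X -> dual X | forall c (f : dual X) p x,
    FM p x -> prf c f (sg mX p x) = rpr gr (p + c) (f (sg mX p x))}.
  have /choice[u uP] : forall cf : int * dual X, exists u : dual X,
      forall p x, FM p x -> u (sg mX p x) = rpr gr (p + cf.1) (cf.2 (sg mX p x)).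
    move=> [c f].
    have [p x y px py|p x px|p q a x pa qx|H HP] := graded_hom_ext mX (Y := S^o)
      (h := fun p x => rpr gr (p + c) (f (sg mX p x))).
    - by rewrite sgD // dual_valD rprD.
    - have px' : FM p x by apply: mfil_le px; lia.
      by rewrite (sg_eq0 mX px').2 // dual_val0 rpr0.
    - by rewrite (sgZ mX) // dual_valZ -addrA rpr_scale.
    by exists H.
  by exists (fun c f => u (c, f)) => c f; exact: (uP (c, f)).
have ext (f g : dual X) : (forall p x, FM p x -> f (sg mX p x) = g (sg mX p x)) -> f = g.
  move=> fg; apply: dualP.
  exact: (hom_sg_ext (mX := mX) (f := (f : {linear X -> S^o})) (g := (g : {linear X -> S^o}))).
have h1 c f g : dualfil gM c f -> dualfil gM c g -> sgf c (f + g) = sgf c f + sgf c g.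
  move=> fc gc'; have fgc := mfilD (FM := dualfil gM) fc gc'.
  apply: ext => p x px; apply: (etrans (sgfP _ _ fgc _ _ px)).
  apply: (etrans (rsgD gr (fc _ _ px) (gc' _ _ px))).
  by rewrite -(sgfP _ _ fc) // -(sgfP _ _ gc').
have h2 c f : dualfil gM c f -> (sgf c f = 0 <-> dualfil gM (c - 1) f).
  move=> fc; split=> [f0 p x px|fc'].
    have pf := fc _ _ px; rewrite addrA; apply/(rsg_eq0 gr pf).
    by rewrite -[LHS](sgfP _ _ fc) // f0.
  apply: ext => p x px; rewrite sgfP //; apply/(rsg_eq0 gr (fc _ _ px)).
  by have := fc' _ _ px; rewrite addrA.
have h3 c c' a f : rfilZ (convfil F) c a -> dualfil gM c' f ->
    sgf (c + c') (a *: f) = rsg gc c a *: sgf c' f.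
  move=> ca fc; have cfc := mfilMZ (FM := dualfil gM) ca fc.
  apply: ext => p x px; rewrite gcE.
  apply: (etrans (sgfP _ _ cfc _ _ px)).
  rewrite -[RHS]/(sgf c' f (sg mX p x) * sr c a) (sgfP _ _ fc) //.
  rewrite -(rsgM gr (fc _ _ px)); last by rewrite -rfilZ_conv.
  by congr (sr _ _); lia.
have h4 c f g : prf c (f + g) = prf c f + prf c g.
  apply: ext => p x px; apply: (etrans (prfP _ _ _ _ px)).
  by apply: (etrans (rprD gr _ _ _)); rewrite -!prfP.
have h5 c f : exists h, dualfil gM c h /\ prf c f = sgf c h.
  have [p x px|h [hc hP]] := lift_symbol (mX := mX) (c := c) (f := (prf c f : {linear X -> S^o})) nS gM vX.
    rewrite -[(prf c f : {linear X -> S^o}) _]/(prf c f (sg mX p x)) prfP //.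
    exact: rpr_idem.
  by exists (h : dual M); split=> //; apply: ext => p x px; rewrite [RHS]sgfP //; exact: hP.
have h6 c c' f : dualfil gM c' f -> prf c (sgf c' f) = if c == c' then sgf c' f else 0.
  move=> fc; apply: ext => p x px; rewrite prfP // sgfP // rpr_rsg; last exact: fc.
  by rewrite (inj_eq (addrI p)); case: eqP => _ //; rewrite sgfP.
have h7 f : exists s : seq int, uniq s /\ f = \sum_(c <- s) prf c f.
  have [r [d [m g]]] := gM; have [fm [fmE _]] := free_model gr d.
  have /choice[s sP] := fun j => gpr_supp (grm gr) (f (sg mX (d j) (m j))).
  (* Finitely many generators bound the degrees: a component of degree [q] of the value at the
     generator [j] comes from [c = q - d j]. *)
  pose t := undup (flatten [seq [seq q - d j | q <- s j] | j <- enum 'I_r]).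
  exists t; split; first exact: undup_uniq.
  apply: dualP => x; have [y <-] := sg_lincomb_surj mX g fmE x; rewrite lincombE.
  rewrite -[LHS]/((f : {linear X -> S^o}) _) -[RHS]/((\sum_(c <- t) prf c f : {linear X -> S^o}) _).
  rewrite !linear_sum; apply: eq_bigr => j _.
  apply: (etrans (dual_valZ f _ _)); apply: (etrans _ (esym (dual_valZ _ _ _))).
  congr (_ * _); rewrite dual_sum.
  have gj := gens_mem g j; under eq_bigr do rewrite prfP //.
  rewrite -(big_map (fun c => d j + c) xpredT (fun p => rpr gr p (f (sg mX (d j) (m j))))).
  apply: (gpr_sumE (mX := grm gr)).
    by rewrite map_inj_uniq ?undup_uniq //; exact: addrI.
  move=> p pt; apply: sP; apply: contraNN pt => ps.
  apply/mapP; exists (p - d j); last by rewrite addrC subrK.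
  rewrite mem_undup; apply/flattenP; exists [seq q - d j | q <- s j].
    by apply: map_f; rewrite mem_enum.
  by apply/mapP; exists p.
exists (@GrModel _ _ _ _ _ (dualfil gM) (dual X) sgf prf h1 h2 h3 h4 h5 h6 h7).
exact: sgfP.
Qed.
End DualModel.

(** * Reflexivity and the transfer of G-dimension zero *)

Section Bidual.
Variables (L : pzRingType) (F : ring_filtration L) (S : pzRingType).
Variable gr : grring F S.
Variables (M : lmodType L) (FM : module_filtration F M) (X : lmodType S).
Variable mX : grmodel (rsg gr) FM X.
Hypotheses (nS : left_noetherian S) (nSc : left_noetherian S^c) (gM : good FM).

Lemma good_dual (gc : grring (convfil F) S^c)
  (mD : grmodel (rsg gc) (dualfil gM) (dual X)) : good (dualfil gM).
Proof.
apply: (good_fin_gen mD); apply: fin_gen_dual nSc _.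
have [r [d [m g]]] := gM; have [fm [fmE _]] := free_model gr d.
exact: (good_fin_gen_model mX g fmE).
Qed.

(** Two uses of [dual_model] make [X^**] a model of [M^**] in which the biduality map of [M] has
    that of [X] as symbol; bijectivity then passes to [M] by induction on the degree. *)
Lemma gdim0_filtered : gdim0 X -> gdim0 M.
Proof.
move=> [/bijectiveP[bi bs] vX vX']; have [gc gcE] := convring_ex gr.
have [mD mDP] := dual_model gcE mX nS gM (vX 0%N).
have gD := good_dual mD.
split=> [|k|k]; [|exact: (vext_filtered nS mX gM)|exact: (vext_filtered nSc mD gD)].
have [gcc gccE] := convring_ex gc.
have [mDD mDDP] := dual_model gccE mD nSc gD (vX' 0%N).
have deg_ev p x : FM p x -> degree_le (dualfil gM) p (bidual_map x : {linear dual M -> L^c^o}).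
  move=> px c f fc; rewrite rfilZ_conv addrC; exact: fc px.
have sg_ev p x : FM p x -> sg mDD p (bidual_map x) = bidual_map (sg mX p x).
  move=> px; apply: dualP.
  apply: (hom_sg_ext (mX := mD)
    (f := (sg mDD p (bidual_map x) : {linear dual X -> S^c^o}))
    (g := (bidual_map (sg mX p x) : {linear dual X -> S^c^o}))) => c f fc.
  rewrite -[LHS]/(sg mDD p (bidual_map x) (sg mD c f)) mDDP //; last exact: deg_ev.
  rewrite -[RHS]/((sg mD c f) (sg mX p x)) mDP // gcE addrC //.
have gpr_ev p x : gpr mDD p (bidual_map x) = bidual_map (gpr mX p x).
  elim/(homog_ind (mX := mX)): x => [|x y hx hy|q x qx].
  - by rewrite gpr0 bidual_map0 gpr0.
  - by rewrite gprD !bidual_mapD gprD hx hy.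
  rewrite -sg_ev // !gpr_sg //; last exact: deg_ev.
  by case: eqP => _; rewrite ?sg_ev ?bidual_map0.
apply/bijectiveP; split=> [x y xy|f].
  apply/eqP; rewrite -subr_eq0; apply/eqP.
  have : @bidual_map L M (x - y) = 0.
    apply: dualP => h; rewrite -[LHS]/(dual_val h (x - y)) dual_valB.
    apply/eqP; rewrite subr_eq0; apply/eqP.
    exact: (congr1 (fun u : dual (dual M) => u h) xy).
  have [p pxy] := mfil_cover FM (x - y).
  (* If evaluation at [z] is zero, so is the symbol of [z], because [X] embeds in [X^**]; hence [z]
     moves down in the filtration. *)
  elim/mfil_ind: p (x - y) / pxy => // p z pz IH z0; apply: (IH) => //.
  apply/(sg_eq0 mX pz)/bi; rewrite -sg_ev // z0 sg0.
  by apply: dualP => g; rewrite -[RHS]/(dual_val g 0) dual_val0.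
have [p pf] := mfil_cover (dualfil gD) f.
elim/mfil_ind: p f / pf => [p|p f pf IH].
  by exists 0; apply: dualP => g; rewrite -[LHS]/(dual_val g 0) dual_val0.
(* [u] need not be homogeneous, but its component of degree [p] has the same image, as projections
   commute with evaluation. *)
have [u uP] := bs (sg mDD p f); have [x [px ux]] := gpr_lift mX p u.
have px' := deg_ev _ _ px.
have fx : sg mDD p f = sg mDD p (bidual_map x).
  by rewrite sg_ev // -ux -gpr_ev uP gpr_sg // eqxx.
have [|y yP] := IH (f - bidual_map x).
  by apply/(sg_eq0 mDD (mfilB (FM := dualfil gD) pf px')); rewrite sgB // fx subrr.
by exists (y + x); rewrite bidual_mapD yP subrK.
Qed.
End Bidual.

(** * The associated graded ring and module *)

Section Transfer.
Variables (L : pzRingType) (F : ring_filtration L) (S : pzRingType).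
Variable gr : grring F S.
Hypotheses (nS : left_noetherian S) (nSc : left_noetherian S^c).

Lemma gres_filtered n (M : lmodType L) (FM : module_filtration F M) (X : lmodType S) :
  grmodel (rsg gr) FM X -> good FM -> gres n X -> gres n M.
Proof.
elim: n M FM X => [|n IH] M FM X mX gM gX.
  apply: gres0; last exact: gdim0_filtered mX nS nSc gM (gres0_gdim0 gX).
  by have [r [d [m g]]] := gM; apply: fin_gen_surj (gens_surj g) (fin_gen_rV _ _).
have [r [d [m g]]] := gM; have [fm [fmE _]] := free_model gr d.
have [K [i [ii [Z [e [mZ [sK sZ mZP]]]]]]] := syzygy_model mX g fmE.
apply: (gres_splice sK); apply: (IH K _ Z mZ); last exact: gres_syzygy nS sZ gX.
apply: (good_fin_gen mZ); case: sZ => ie _ _.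
exact: noeth_fin_gen nS _ (fin_gen_rV _ _) _ _ ie.
Qed.
End Transfer.

(** * Homogeneous elements of a direct sum of quotients *)

Section Homogeneous.
Variables (I : choiceType) (V : zmodType) (D : subquot I V).
Implicit Types (i j : I) (v w : V) (x y : dsum D).

Definition single i v : I -> V := fun j => if j == i then v else 0.

Lemma single_is_family i v : num D i v -> is_family D (single i v).
Proof.
move=> iv; split=> [|j]; last first.
  by rewrite /single; case: eqP => [->|_] //; exact: (numP D j).1.
apply: (@sub_finite_set _ _ [set i]); last exact: finite_set1.
by move=> j /=; rewrite /single; case: (j =P i) => // _ /eqP.
Qed.

(** Total in [v], as the field [sg] must be; the value 0 outside [num D i] is a mere default. *)
Definition hcls i v : dsum D :=
  if pselect (num D i v) is left iv then cls (mk_family (single_is_family iv)) else 0.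

Lemma hclsP i v : num D i v ->
  exists f : family D, (f =1 single i v) /\ hcls i v = cls f.
Proof.
rewrite /hcls; case: pselect => // iv _.
by exists (mk_family (single_is_family iv)).
Qed.

Lemma cls0 : cls (0 : family D) = 0.
Proof. by apply: (addrI (cls (0 : family D))); rewrite -clsD !addr0. Qed.

Lemma familyD (f g : family D) j : (f + g) j = f j + g j.
Proof. by []. Qed.

Lemma hcls_eq0 i v : num D i v -> (hcls i v = 0 <-> den D i v).
Proof.
move=> iv; have [f [fE ->]] := hclsP iv; rewrite -cls0 clsE; split=> [/(_ i)|iv' j].
  by rewrite fE /single eqxx subr0.
rewrite fE subr0 /single; case: eqP => [->|_] //; exact: (denP D j).1.
Qed.

Lemma hclsD i v w : num D i v -> num D i w -> hcls i (v + w) = hcls i v + hcls i w.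
Proof.
move=> iv iw; have ivw := subgroupD (numP D i) iv iw.
have [f [fE ->]] := hclsP iv; have [g [gE ->]] := hclsP iw.
have [h [hE ->]] := hclsP ivw; rewrite -clsD; apply/clsE => j.
rewrite familyD fE gE hE /single; case: eqP => _; rewrite ?addr0 subrr; exact: (denP D j).1.
Qed.

Lemma hcls_eq i v w : num D i v -> num D i w -> den D i (v - w) -> hcls i v = hcls i w.
Proof.
move=> iv iw ivw; have ivw' := (numP D i).2 _ _ iv iw.
by rewrite -(subrK w v) hclsD // (hcls_eq0 ivw').2 ?add0r.
Qed.

Definition proj i x : dsum D := hcls i (rep x i).

Lemma rep_num x i : num D i (rep x i).
Proof. exact: (familyP (rep x)).2. Qed.

(** Representatives are additive only up to [den D i], which [hcls] does not see. *)
Lemma projD i x y : proj i (x + y) = proj i x + proj i y.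
Proof.
have ix := rep_num x i; have iy := rep_num y i.
rewrite /proj -hclsD //; apply: hcls_eq; [exact: rep_num|exact: (subgroupD (numP D i) ix iy)|].
by rewrite -{1}(repK x) -{1}(repK y) -clsD -familyD; exact: rep_cls.
Qed.

Lemma proj_hcls i j v : num D j v -> proj i (hcls j v) = if i == j then hcls j v else 0.
Proof.
move=> jv; have [f [fE fj]] := hclsP jv; rewrite /proj fj.
have := rep_cls f i; rewrite fE /single; case: eqP => [->|_] d.
  by rewrite -fj; apply: hcls_eq; [exact: rep_num| |rewrite fj].
by rewrite subr0 in d; apply/hcls_eq0 => //; exact: rep_num.
Qed.

Lemma proj_fin x : exists s : seq I, uniq s /\ x = \sum_(i <- s) proj i x.
Proof.
have [/finite_seqP[s sP] _] := familyP (rep x).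
exists (undup s); split; first exact: undup_uniq.
(* An explicit family representing each partial sum allows classes to be compared coordinatewise. *)
have H (t : seq I) : exists2 f : family D, cls f = \sum_(i <- t) proj i x &
    forall j, f j = \sum_(i <- t) single i (rep x i) j.
  elim: t => [|i t [f ft fE]]; first by exists 0 => [|j]; rewrite big_nil ?cls0.
  have [g [gE gi]] := hclsP (rep_num x i).
  exists (g + f) => [|j]; rewrite big_cons; first by rewrite clsD ft -gi.
  by rewrite familyD gE fE.
have [f <- fE] := H (undup s); rewrite -{1}(repK x); apply/clsE => j.
suff -> : f j = rep x j by rewrite subrr; exact: (denP D j).1.
rewrite fE; have [js|js] := boolP (j \in undup s).
  rewrite (bigD1_seq j) ?undup_uniq //= /single eqxx big1 ?addr0 // => i.
  by rewrite eq_sym => /negPf ->.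
rewrite big_seq big1 => [|i it]; last first.
  by rewrite /single; case: eqP => // ji; rewrite ji it in js.
apply/esym/eqP; apply: contraNT js => jx; rewrite mem_undup.
have : [set i | rep x i != 0] j by [].
by rewrite sP.
Qed.
End Homogeneous.

Section ConcreteModels.
Variables (L : pzRingType) (F : ring_filtration L).
Local Notation D := (ring_subquot F).

(** Models are graded by the integers and the filtration of [L] by the naturals, whence 0 in
    negative degrees. *)
Definition gr_sg (p : int) (a : L) : gr_ring F :=
  if p is Posz n then hcls D n a else 0.

Definition gr_pr (p : int) (x : gr_ring F) : gr_ring F :=
  if p is Posz n then proj n x else 0.

(** In the convolution of families concentrated in degrees [n] and [k] only the term [i = n]
    survives, and only at [n + k]. *)
Lemma gr_sgM_nat (n k : nat) a b : F n a -> F k b ->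
  gr_sg (n + k)%N (a * b) = gr_sg n a * gr_sg k b.
Proof.
move=> na kb; rewrite /gr_sg.
have [f [fE ->]] := hclsP (D := D) na; have [g [gE ->]] := hclsP (D := D) kb.
have [h [hE ->]] := hclsP (D := D) (rfilM na kb).
rewrite -[RHS]/(gr_mul _ _) gr_mulE; apply/clsE => l.
suff -> : h l = fam_mul f g l by rewrite subrr; exact: (denP D l).1.
rewrite hE /= /conv /single; have [nl|nl] := ltnP l n.
  rewrite (_ : (l == _) = false); last lia.
  rewrite big1 // => i _; rewrite fE /single (_ : (_ == _) = false) ?mul0r //.
  by have := ltn_ord i; lia.
rewrite (bigD1 (Ordinal (nl : (n < l.+1)%N))) //= big1 ?addr0 => [|i ni].
  rewrite fE gE /single eqxx; have -> : (l - n == k)%N = (l == n + k)%N by lia.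
  by case: eqP => _; rewrite ?mulr0.
by rewrite fE /single (_ : (_ == _) = false) ?mul0r //; move: ni; rewrite -val_eqE /= => /negPf.
Qed.

Lemma gr_sgM p q a b : rfilZ F p a -> rfilZ F q b ->
  gr_sg (p + q) (a * b) = gr_sg p a * gr_sg q b.
Proof.
have gr_sg0 r : gr_sg r 0 = 0.
  case: r => //= n; apply/(hcls_eq0 (D := D)); first exact: (numP D n).1.
  exact: (denP D n).1.
case: p => [n|n] /=; last by move=> -> _; rewrite !mul0r gr_sg0.
case: q => [k|k] /= na; last by move=> ->; rewrite !mulr0 gr_sg0.
exact: gr_sgM_nat.
Qed.

Lemma gr_ring_model : exists gr : grring F (gr_ring F), rsg gr = gr_sg.
Proof.
have h1 p x y : regfil F p x -> regfil F p y ->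
    (gr_sg p (x + y) : (gr_ring F)^o) = gr_sg p x + gr_sg p y.
  case: p => [n|n] /= px py; last by rewrite addr0.
  exact: (hclsD (D := D) px py).
have h2 p x : regfil F p x -> ((gr_sg p x : (gr_ring F)^o) = 0 <-> regfil F (p - 1) x).
  case: p => [n|n] /= px; first exact: (hcls_eq0 (D := D) px).
  by split=> // _; rewrite (px : x = 0); exact: (rfilZ_subgroup _ _).1.
have h3 p q a x : rfilZ F p a -> regfil F q x ->
    (gr_sg (p + q) (a *: x) : (gr_ring F)^o) = gr_sg p a *: (gr_sg q x : (gr_ring F)^o).
  exact: gr_sgM.
have h4 p (x y : (gr_ring F)^o) : (gr_pr p (x + y) : (gr_ring F)^o) = gr_pr p x + gr_pr p y.
  by case: p => [n|n] /=; [exact: projD|rewrite addr0].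
have h5 p (x : (gr_ring F)^o) : exists m, regfil F p m /\ (gr_pr p x : (gr_ring F)^o) = gr_sg p m.
  case: p => [n|n] /=; last by exists 0.
  by exists (rep (x : gr_ring F) n); split=> //; exact: (rep_num (D := D)).
have h6 p q m : regfil F q m ->
    (gr_pr p (gr_sg q m) : (gr_ring F)^o) = if p == q then gr_sg q m else 0.
  case: q => [k|k] /= qm; case: p => [n|n] //=; last by case: ifP.
    exact: (proj_hcls (D := D)).
  have z0 : num D n 0 by exact: (numP D n).1.
  (* The symbol is 0 here; written as a class of degree [n], it falls under [proj_hcls]. *)
  rewrite -[X in proj _ X](hcls_eq0 z0).2; last exact: (denP D n).1.
  rewrite proj_hcls // eqxx; apply/(hcls_eq0 z0); exact: (denP D n).1.
have h7 (x : (gr_ring F)^o) : exists s : seq int, uniq s /\ x = \sum_(p <- s) (gr_pr p x : (gr_ring F)^o).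
  have [s [us xs]] := proj_fin (x : gr_ring F); exists (map Posz s).
  split; first by rewrite map_inj_uniq // => ? ? [].
  by rewrite [RHS]big_map.
have h8 : gr_sg 0 1 = 1.
  have [f [fE fc]] := hclsP (D := D) (rfil1 F); rewrite /= fc.
  rewrite -[RHS]/(gr_one F); apply/clsE => j; rewrite fE /=.
  by rewrite (_ : single _ _ _ = delta1 L j) ?subrr; [exact: (denP D j).1|case: j].
by exists (@GrRing L F (gr_ring F) gr_sg (GrModel h1 h2 h3 h4 h5 h6 h7)
  (fun p a => erefl) h8).
Qed.

Section GrMod.
Variables (M : lmodType L) (FM : module_filtration F M).
Local Notation E := (module_subquot FM).

Lemma hcls_scale_nat (n : nat) q a m : F n a -> FM q m ->
  hcls E (n%:Z + q) (a *: m) = (gr_sg n a : gr_ring F) *: (hcls E q m : gr_mod FM).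
Proof.
move=> na qm; rewrite /gr_sg.
have [f [fE ->]] := hclsP (D := D) na; have [g [gE ->]] := hclsP (D := E) qm.
have [h [hE ->]] := hclsP (D := E) (mfilM na qm).
rewrite -[RHS]/(gr_scale _ _) gr_scaleE; apply/clsE => l.
suff -> : h l = fam_scale f g l by rewrite subrr; exact: (denP E l).1.
rewrite hE /= (actE (N := n.+1)) => [|i ni]; last first.
  by rewrite fE /single (_ : (_ == _) = false) //; lia.
rewrite big_ord_recr /= big1 ?add0r => [|i _]; last first.
  rewrite fE /single (_ : (_ == _) = false) ?scale0r //.
  by have := ltn_ord i; lia.
rewrite fE gE /single eqxx; have -> : (l - n%:Z == q) = (l == n%:Z + q) by lia.
by case: eqP => _; rewrite ?scaler0.
Qed.

Lemma gr_mod_model : inhabited (grmodel gr_sg FM (gr_mod FM)).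
Proof.
have h3 p q a x : rfilZ F p a -> FM q x ->
    (hcls E (p + q) (a *: x) : gr_mod FM) = gr_sg p a *: (hcls E q x : gr_mod FM).
  case: p => [n|n] /=; first exact: hcls_scale_nat.
  move=> -> _; rewrite !scale0r; apply/(hcls_eq0 (D := E)); first exact: mfil0.
  exact: mfil0.
have h5 p (x : gr_mod FM) : exists m, FM p m /\ (proj p x : gr_mod FM) = hcls E p m.
  by exists (rep x p); split=> //; exact: (rep_num (D := E)).
constructor; exact: (@GrModel _ _ _ _ _ FM (gr_mod FM) (hcls E) (@proj _ _ E)
  (fun p x y => @hclsD _ _ E p x y) (fun p x => @hcls_eq0 _ _ E p x) h3
  (@projD _ _ E) h5 (fun p q m => @proj_hcls _ _ E p q m) (@proj_fin _ _ E)).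
Qed.
End GrMod.
End ConcreteModels.

(** * Comparison of the two G-dimensions *)

Lemma Gdim_le_gres (R : pzRingType) n (X : lmodType R) :
  Gdim_le n X <-> if n is 0 then gdim0 X else gres n X.
Proof.
case: n => [|n]; first exact: Gdim_eq0P.
by split=> -[G [G1 G2]]; exists G; split=> // i /G1[fi gi]; split=> //; exact/Gdim_eq0P.
Qed.

Lemma Gdim_le_gr (L : pzRingType) (F : ring_filtration L)
    (M : lmodType L) (FM : module_filtration F M) n :
  (forall x y : gr_ring F, x * y = y * x) -> left_noetherian (gr_ring F) ->
  good_filtration FM -> Gdim_le n (gr_mod FM) -> Gdim_le n M.
Proof.
move=> grC nS /good_filtrationP gM; have nSc := left_noetherian_conv grC nS.
have [gr grE] := gr_ring_model F; have [mX] := gr_mod_model FM.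
(* The case [n = 0] is apart because [Gdim_le 0] is a condition on duals and not on a resolution. *)
rewrite -grE in mX; rewrite !Gdim_le_gres; case: n => [|n].
  exact: gdim0_filtered mX nS nSc gM.
by move=> gX; have := gres_filtered nS nSc mX gM gX.
Qed.

Theorem theorem2p3 (L : pzRingType) (F : ring_filtration L)
    (M : lmodType L) (FM : module_filtration F M)
    (grL_comm : forall x y : gr_ring F, x * y = y * x)
    (grL_noeth : left_noetherian (gr_ring F))
    (FM_good : good_filtration FM)
    (grM_fin : (Gdim (gr_mod FM) < +oo)%E) :
  (Gdim M <= Gdim (gr_mod FM))%E.
Proof.
move: grM_fin; rewrite {1 3}/Gdim; case: pselect => // Xfin _.
case: ex_minnP => n /asboolP Xn _.
have Mn := Gdim_le_gr grL_comm grL_noeth FM_good Xn.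
rewrite /Gdim; case: pselect => [Mfin|[]]; last by exists n.
case: ex_minnP => k _ /(_ n (asboolT Mn)) kn.
by rewrite constructive_ereal.lee_fin lez_nat.
Qed.
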